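(* Let $\nu>0$. There exist constants $C_l,C_u>0$ realizing the equivalence $C_l\|\chi\|_G\le\|\chi\|\le C_u\|\chi\|_G$ of the $G$-norm and the $L^2(\Omega)$ norm such that the following holds, with $\alpha:=\min\{\tfrac12,\tfrac{\nu\Delta t\,C_l^2}{4}\}$. (i) Let $f\in L^\infty(0,\infty;V_h^* )$ and $u_0\in H^1(\Omega)$. Then for any $\Delta t>0$, solutions of the BDF2 velocity-vorticity algorithm (described in the context) satisfy, for every positive integer $n$, $$C_l^2\left(\|u_h^n\|^2+\|u_h^{n-1}\|^2\right)+\frac{\nu\Delta t}{4}\|\nabla u_h^n\|^2\le\left(\frac1{1+\alpha}\right)^n\left(2C_u\|u_h^0\|^2+\frac{\nu\Delta t}{4}\|\nabla u_h^0\|^2\right)+\max\left(2\Delta t,\frac{4}{\nu C_l^2}\right)\nu^{-1}\|f\|^2_{L^\infty(0,\infty;V_h^* )}.$$ (ii) If additionally $f\in L^\infty(0,\infty;L^2(\Omega))$ and $w_h^0\in H^1(\Omega)$, then for any $\Delta t>0$, solutions of the same algorithm satisfy, for every positive integer $n$, $$C_l^2\left(\|w_h^n\|^2+\|w_h^{n-1}\|^2\right)+\frac{\nu\Delta t}{4}\|\nabla w_h^n\|^2\le\left(\frac1{1+\alpha}\right)^n\left(2C_u\|w_h^0\|^2+\frac{\nu\Delta t}{4}\|\nabla w_h^0\|^2\right)+\max\left(2\Delta t,\frac{4}{\nu C_l^2}\right)\nu^{-1}\|f\|^2_{L^\infty(0,\infty;L^2(\Omega))}.$$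
   Context: Setting. $\Omega=(0,2\pi)^2\subset\mathbb{R}^2$ with periodic boundary conditions; all functions (including $f$ and $u_0$) are $2\pi$-periodic in each direction with zero mean. $(\cdot,\cdot)$ and $\|\cdot\|$ are the $L^2(\Omega)$ inner product (or duality pairing) and norm. $X=H^1_\#(\Omega)^2$, $Q=L^2_\#(\Omega)$, $Y=H^1_\#(\Omega)$, where $\#$ denotes $2\pi$-periodic functions of zero mean ($X$ is vector valued; $Q$, $Y$ scalar valued). Discretization. $\tau_h$ is a regular, conforming triangulation of $\Omega$ compatible with the periodic boundary conditions; $X_h\subset X$, $Q_h\subset Q$, $Y_h\subset Y$ are piecewise polynomial finite element spaces on $\tau_h$, with $(X_h,Q_h)$ inf-sup stable. $V_h=\{v_h\in X_h:(\nabla\cdot v_h,q_h)=0\ \forall q_h\in Q_h\}$; $V_h^*$ is its dual, with norm $\|f\|_{V_h^*}=\sup_{0\neq v_h\in V_h}(f,v_h)/\|\nabla v_h\|$. $G$-norm. $G=\begin{pmatrix}1/2&-1\\-1&5/2\end{pmatrix}$; for a pair $\chi=[\chi_1,\chi_2]^T$ of $L^2(\Omega)$ functions (scalar or vector valued), $\|\chi\|_G^2=(\chi,G\chi)$ and $\|\chi\|^2=\|\chi_1\|^2+\|\chi_2\|^2$. These norms are equivalent, i.e. there exist constants $C_l,C_u$ with $C_l\|\chi\|_G\le\|\chi\|\le C_u\|\chi\|_G$ for all $\chi$. For scalar $w$ and $u=(u_1,u_2)$, $w\times u:=(-u_2w,\,u_1w)^T$. For a vector field $f=(f_1,f_2)$,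 $\nabla\times f=\partial_1f_2-\partial_2f_1$; for $f\in L^2$, $(\nabla\times f,\chi)$ is understood after integration by parts, i.e. as $\int_\Omega(f_1\partial_2\chi-f_2\partial_1\chi)\,dx$. The trilinear form $b^*:X_h\times Y_h\times Y_h\to\mathbb{R}$ is $b^*(u,w,\chi)=(u\cdot\nabla w,\chi)+\frac12((\nabla\cdot u)w,\chi)$. BDF2 velocity-vorticity algorithm. $\nu>0$ is the viscosity, $\Delta t>0$ the time step, $t^n=n\Delta t$, $f^n=f(t^n)$. Given $f$ and $u_0$, let $u_h^{-1}=u_h^0\in X_h$ be the interpolant of $u_0$ and $w_h^{-1}=w_h^0\in Y_h$ the interpolant of $\nabla\times u_0$. For $n=0,1,2,\dots$: Step 1: find $(u_h^{n+1},P_h^{n+1})\in(X_h,Q_h)$ such that for all $(v_h,q_h)\in(X_h,Q_h)$, $$\tfrac1{2\Delta t}(3u_h^{n+1}-4u_h^n+u_h^{n-1},v_h)+((2w_h^n-w_h^{n-1})\times u_h^{n+1},v_h)-(P_h^{n+1},\nabla\cdot v_h)+\nu(\nabla u_h^{n+1},\nabla v_h)=(f^{n+1},v_h),\qquad(\nabla\cdot u_h^{n+1},q_h)=0.$$ Step 2: find $w_h^{n+1}\in Y_h$ such that for all $\chi_h\in Y_h$, $$\tfrac1{2\Delta t}(3w_h^{n+1}-4w_h^n+w_h^{n-1},\chi_h)+b^*(u_h^{n+1},w_h^{n+1},\chi_h)+\nu(\nabla w_h^{n+1},\nabla\chi_h)=(\nabla\times f^{n+1},\chi_h).$$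
   Formalization: Since the scheme uses the point values f(t^n), f is taken as a representative whose norm at every t>0 is at most its essential supremum; otherwise changing f at the single times t^n would make the bounds false. Every class has such a representative. *)

(* Defs.v *)
From mathcomp Require Import all_boot all_order all_algebra.
From mathcomp Require Import all_classical all_reals all_analysis.
From mathcomp Require Import ess_sup_inf.

Set Implicit Arguments.
Unset Strict Implicit.
Unset Printing Implicit Defensive.
Import Order.TTheory GRing.Theory Num.Theory.
Import numFieldNormedType.Exports.
Local Open Scope classical_set_scope.
Local Open Scope ring_scope.

(* A field is a function on the whole plane, 2pi-periodic in each direction;
   elements of L^2 and H^1 are handled through such representatives, and
   integrals and norms are taken over one period. *)

Notation plane R := (R * R)%type (only parsing).
Notation sfield R := ((R * R)%type -> R) (only parsing).
Notation vfield R := (((R * R)%type -> R) * ((R * R)%type -> R))%type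
  (only parsing).

Section Fields.
Variable R : realType.
Implicit Types (u w q phi chi : sfield R) (v g : vfield R).

Definition Omega : set (measurableTypeR R * measurableTypeR R) :=
  `]0, 2 * pi[ `*` `]0, 2 * pi[.

Definition leb2 := (@lebesgue_measure R \x @lebesgue_measure R)%E.

Definition sip u w : R := \int[leb2]_(x in Omega) (u x * w x).
Definition vip v1 v2 : R := sip v1.1 v2.1 + sip v1.2 v2.2.
Definition snorm u : R := Num.sqrt (sip u u).
Definition vnorm v : R := Num.sqrt (vip v v).

Definition L2 u : Prop :=
  measurable_fun Omega u /\
  leb2.-integrable Omega (fun x => (u x ^+ 2)%:E).
Definition vL2 v : Prop := L2 v.1 /\ L2 v.2.

Definition periodic u : Prop :=
  forall x : plane R, u (x.1 + 2 * pi, x.2) = u x /\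
                      u (x.1, x.2 + 2 * pi) = u x.

Definition zero_mean u : Prop := \int[leb2]_(x in Omega) (u x) = 0.

(* L^2_#, the pressure space Q, and its vector-valued version *)
Definition L2per : set (sfield R) :=
  [set u | [/\ periodic u, L2 u & zero_mean u]].
Definition vL2per : set (vfield R) := [set v | L2per v.1 /\ L2per v.2].

Definition partial1 phi : sfield R := fun x => 'D_((1, 0) : R * R) phi x.
Definition partial2 phi : sfield R := fun x => 'D_((0, 1) : R * R) phi x.

Fixpoint Ck (k : nat) phi : Prop :=
  continuous phi /\
  if k is k'.+1 then
    [/\ forall x, derivable phi x (1, 0),
        forall x, derivable phi x (0, 1),
        Ck k' (partial1 phi) & Ck k' (partial2 phi)]
  else True.

Definition smooth phi : Prop := forall k, Ck k phi.

(* H^1 of the torus is the closure, for the H^1 norm, of the smooth periodic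
   functions: g is the gradient of u when some sequence of smooth periodic
   functions converges to u in L^2 while its gradients converge to g in L^2. *)
Definition is_grad u g : Prop :=
  [/\ periodic u /\ L2 u,
      (periodic g.1 /\ L2 g.1) /\ (periodic g.2 /\ L2 g.2) &
      exists phi : nat -> sfield R,
        [/\ forall k, smooth (phi k) /\ periodic (phi k),
            (fun k => snorm (phi k - u)) @ \oo --> (0 : R),
            (fun k => snorm (partial1 (phi k) - g.1)) @ \oo --> (0 : R) &
            (fun k => snorm (partial2 (phi k) - g.2)) @ \oo --> (0 : R)]].

(* The gradient is unique up to a null set; a representative is chosen. *)
Definition grad u : vfield R := xget (0 : vfield R) [set g | is_grad u g].

(* H^1_#, the space Y, and its vector-valued version X *)
Definition H1per : set (sfield R) :=
  [set u | L2per u /\ exists g, is_grad u g].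
Definition vH1per : set (vfield R) := [set v | H1per v.1 /\ H1per v.2].

Definition div v : sfield R := (grad v.1).1 + (grad v.2).2.
Definition curl v : sfield R := (grad v.2).1 - (grad v.1).2.

Definition gradip v1 v2 : R :=
  vip (grad v1.1) (grad v2.1) + vip (grad v1.2) (grad v2.2).
Definition gradnorm v : R := Num.sqrt (gradip v v).

Definition wcross w v : vfield R :=
  ((fun x => - (v.2 x * w x)), (fun x => v.1 x * w x)).

Definition bstar v w chi : R :=
  sip (fun x => v.1 x * (grad w).1 x + v.2 x * (grad w).2 x) chi
  + 2^-1 * sip (fun x => div v x * w x) chi.

(* (curl f, chi) for f in L^2, integrated by parts *)
Definition curl_pairing v chi : R :=
  \int[leb2]_(x in Omega)
    (v.1 x * (grad chi).2 x - v.2 x * (grad chi).1 x).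

(* The G-norm, for pairs of elements of a space V with inner product ip *)
Definition Gmx : 'M[R]_2 :=
  \matrix_(i, j) (if i == j then (if i == 0 then 1 / 2 else 5 / 2) else -1).

Definition Gnorm (V : lmodType R) (ip : V -> V -> R) (chi : 'I_2 -> V) : R :=
  Num.sqrt (\sum_i ip (chi i) (\sum_j Gmx i j *: chi j)).

Definition pairnorm (V : lmodType R) (ip : V -> V -> R) (chi : 'I_2 -> V) : R :=
  Num.sqrt (\sum_i ip (chi i) (chi i)).

Definition G_equivalence (Cl Cu : R) : Prop :=
  (forall chi : 'I_2 -> sfield R, (forall i, L2 (chi i)) ->
     Cl * Gnorm sip chi <= pairnorm sip chi <= Cu * Gnorm sip chi) /\
  (forall chi : 'I_2 -> vfield R, (forall i, vL2 (chi i)) ->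
     Cl * Gnorm vip chi <= pairnorm vip chi <= Cu * Gnorm vip chi).

End Fields.

Section Mesh.
Variable R : realType.

(* A mesh is a finite family of triangles, each given by its three vertices. *)
Definition triangle : Type := 'I_3 -> plane R.

Definition barycenter (K : triangle) (l : 'I_3 -> R) : plane R :=
  (\sum_i l i * (K i).1, \sum_i l i * (K i).2).

(* convex hull of the vertices of K with index in A *)
Definition face (K : triangle) (A : {set 'I_3}) : set (plane R) :=
  [set x | exists l : 'I_3 -> R,
     [/\ forall i, 0 <= l i, forall i, i \notin A -> l i = 0,
         \sum_i l i = 1 & x = barycenter K l]].

Definition closed_triangle (K : triangle) : set (plane R) :=
  face K [set: 'I_3]%SET.

Definition open_triangle (K : triangle) : set (plane R) :=
  [set x | exists l : 'I_3 -> R,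
     [/\ forall i, 0 < l i, \sum_i l i = 1 & x = barycenter K l]].

Definition vx (K : triangle) (k : nat) : plane R := K (inord k).

Definition area (K : triangle) : R :=
  `| ((vx K 1).1 - (vx K 0).1) * ((vx K 2).2 - (vx K 0).2)
     - ((vx K 2).1 - (vx K 0).1) * ((vx K 1).2 - (vx K 0).2) | / 2.

Definition dist2 (a b : plane R) : R :=
  Num.sqrt ((a.1 - b.1) ^+ 2 + (a.2 - b.2) ^+ 2).

Definition perimeter (K : triangle) : R :=
  dist2 (vx K 0) (vx K 1) + dist2 (vx K 1) (vx K 2) + dist2 (vx K 2) (vx K 0).

(* The diameter of the inscribed disc of K is 4 * area / perimeter, and the
   diameter of K is its longest edge. *)
Definition shape_regular (sigma : R) (N : nat) (T : 'I_N -> triangle) : Prop :=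
  forall k i j, dist2 (T k i) (T k j) <=
    sigma * (4 * area (T k) / perimeter (T k)).

Definition is_edge (N : nat) (T : 'I_N -> triangle) (a b : plane R) : Prop :=
  exists k i j, [/\ i != j, T k i = a & T k j = b].

Definition common_vertices (K L : triangle) : {set 'I_3} :=
  [set i | [exists j, (L j == K i :> R * R)]]%SET.

(* The last two clauses say that opposite sides of the square carry the same
   boundary edges up to translation, so that the mesh is conforming on the
   torus. *)
Definition periodic_triangulation (N : nat) (T : 'I_N -> triangle) : Prop :=
  [/\ forall k, 0 < area (T k),
      \bigcup_k closed_triangle (T k) = `[0, 2 * pi] `*` `[0, 2 * pi],
      forall k l, k != l ->
        open_triangle (T k) `&` open_triangle (T l) = set0 /\
        closed_triangle (T k) `&` closed_triangle (T l) =
          face (T k) (common_vertices (T k) (T l)),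
      forall a b, a.1 = 0 -> b.1 = 0 ->
        is_edge T a b <-> is_edge T (2 * pi, a.2) (2 * pi, b.2) &
      forall a b, a.2 = 0 -> b.2 = 0 ->
        is_edge T a b <-> is_edge T (a.1, 2 * pi) (b.1, 2 * pi)].

(* On each open triangle, u is a polynomial of total degree at most d. *)
Definition piecewise_poly (d N : nat) (T : 'I_N -> triangle)
    (u : sfield R) : Prop :=
  forall k, exists c : nat -> nat -> R, forall x, open_triangle (T k) x ->
    u x = \sum_(i < d.+1) \sum_(j < d.+1 - i) c i j * x.1 ^+ i * x.2 ^+ j.

Definition linear_subspace (V : lmodType R) (S : set V) : Prop :=
  S 0 /\ forall (a : R) (u v : V), S u -> S v -> S (a *: u + v).

(* "v <> 0" is meant in L^2, hence the conditions on snorm and vnorm. *)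
Definition inf_sup_stable (Xh : set (vfield R)) (Qh : set (sfield R)) : Prop :=
  exists2 beta : R, 0 < beta &
    forall q, Qh q -> snorm q != 0 ->
      ((beta * snorm q)%:E <=
       ereal_sup [set (sip q (div v) / gradnorm v)%:E |
                   v in [set v | Xh v /\ vnorm v != 0%R]])%E.

Record fe_discretization := FEDiscretization {
  ncells : nat;
  mesh : 'I_ncells -> triangle;
  regularity : R;
  degree : nat;
  Xh : set (vfield R);
  Qh : set (sfield R);
  Yh : set (sfield R);
  mesh_triangulation : periodic_triangulation mesh;
  mesh_regular : shape_regular regularity mesh;
  Xh_subspace : linear_subspace Xh;
  Qh_subspace : linear_subspace Qh;
  Yh_subspace : linear_subspace Yh;
  Xh_vH1per : Xh `<=` @vH1per R;
  Qh_L2per : Qh `<=` @L2per R;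
  Yh_H1per : Yh `<=` @H1per R;
  Xh_piecewise_poly : forall v, Xh v ->
    piecewise_poly degree mesh v.1 /\ piecewise_poly degree mesh v.2;
  Qh_piecewise_poly : forall q, Qh q -> piecewise_poly degree mesh q;
  Yh_piecewise_poly : forall w, Yh w -> piecewise_poly degree mesh w;
  Xh_Qh_inf_sup : inf_sup_stable Xh Qh
}.

Definition Vh (D : fe_discretization) : set (vfield R) :=
  [set v | Xh D v /\ forall q, Qh D q -> sip (div v) q = 0].

(* When Vh is trivial this is the supremum of the empty set, -oo, whose real
   part [fine] is 0. *)
Definition dual_norm (D : fe_discretization) (F : vfield R -> R) : \bar R :=
  ereal_sup [set (F v / gradnorm v)%:E |
              v in [set v | Vh D v /\ vnorm v != 0%R]].

(* Linear functionals on a space of representatives, compatible with equality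
   almost everywhere *)
Definition is_functional (V : lmodType R) (nrm : V -> R) (S : set V)
    (F : V -> R) : Prop :=
  (forall (a : R) (u v : V), S u -> S v -> F (a *: u + v) = a * F u + F v) /\
  (forall u, S u -> nrm u = 0 -> F u = 0).

End Mesh.

Section TimeSpaces.
Variable R : realType.

Definition leb_pos :=
  mrestr (@lebesgue_measure R) (measurable_itv `]0%R, +oo[).

Definition Linf_enorm (N : R -> \bar R) : \bar R := ess_sup leb_pos N.
Definition Linf_norm (N : R -> \bar R) : R := fine (Linf_enorm N).

(* The scheme evaluates f at the times t^n.  An element of L^infty(0,oo;Z) is
   therefore given by a representative whose values are all bounded in norm by
   the essential supremum; every class has one, and every bounded continuous
   function of time is one. *)
Definition Linf_bounded (N : R -> \bar R) : Prop :=
  (Linf_enorm N < +oo)%E /\ forall t, 0 < t -> (N t <= Linf_enorm N)%E.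

(* Only the restrictions of the f t to Vh are measured, but the scheme applies
   them to all of Xh.  As Vh is finite dimensional, measurability in Vh^* is
   measurability of each pairing. *)
Definition Linf_dual (D : fe_discretization R) (f : R -> vfield R -> R) : Prop :=
  [/\ forall t, 0 < t -> is_functional (@vnorm R) (Xh D) (f t),
      forall v, Vh D v ->
        measurable_fun (`]0, +oo[%classic : set (measurableTypeR R))
          (fun t => f t v : measurableTypeR R) &
      Linf_bounded (fun t => dual_norm D (f t))].

(* L^2 is separable, so weak and strong measurability agree. *)
Definition Linf_L2 (f : R -> vfield R) : Prop :=
  [/\ forall t, 0 < t -> vL2per (f t),
      forall v, vL2per v ->
        measurable_fun (`]0, +oo[%classic : set (measurableTypeR R))
          (fun t => vip (f t) v : measurableTypeR R) &
      Linf_bounded (fun t => (vnorm (f t))%:E)].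

End TimeSpaces.

Section Scheme.
Variable R : realType.

(* [f t v] is the pairing (f(t), v) and [curlf t chi] is (curl f(t), chi).
   With u_h^{-1} = u_h^0, the value u_h^{n-1} is [u n.-1] for every n >= 0,
   since the predecessor of 0 is 0; likewise for w. *)
Definition bdf2_solution (nu dt : R) (D : fe_discretization R)
    (IX : vfield R -> vfield R) (IY : sfield R -> sfield R)
    (f : R -> vfield R -> R) (curlf : R -> sfield R -> R) (u0 : vfield R)
    (u : nat -> vfield R) (P : nat -> sfield R) (w : nat -> sfield R) : Prop :=
  [/\ u 0 = IX u0 /\ w 0 = IY (curl u0),
      forall n, Xh D (u n) /\ Yh D (w n),
      forall n, Qh D (P n.+1),
      forall n,
        (forall v, Xh D v ->
           1 / (2 * dt)
             * vip (3%:R *: u n.+1 - 4%:R *: u n + u n.-1 : vfield R) v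
           + vip (wcross (2%:R *: w n - w n.-1 : sfield R) (u n.+1)) v
           - sip (P n.+1) (div v)
           + nu * gradip (u n.+1) v
           = f (n.+1%:R * dt) v) /\
        (forall q, Qh D q -> sip (div (u n.+1)) q = 0) &
      forall n chi, Yh D chi ->
        1 / (2 * dt)
          * sip (3%:R *: w n.+1 - 4%:R *: w n + w n.-1 : sfield R) chi
        + bstar (u n.+1) (w n.+1) chi
        + nu * vip (grad (w n.+1)) (grad chi)
        = curlf (n.+1%:R * dt) chi].

(* The interpolation operators are arbitrary: only the fact that the
   interpolants belong to the discrete spaces is recorded. *)
Definition interpolations (D : fe_discretization R)
    (IX : vfield R -> vfield R) (IY : sfield R -> sfield R) : Prop :=
  (forall v, vH1per v -> Xh D (IX v)) /\ (forall q, L2per q -> Yh D (IY q)).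

End Scheme.

(* Main.v *)
Require Import Defs.
From mathcomp Require Import all_boot all_order all_algebra.
From mathcomp Require Import all_classical all_reals all_analysis.
From mathcomp Require Import measurable_realfun ring lra.
Import Order.TTheory GRing.Theory Num.Theory.
Import numFieldNormedType.Exports.
Local Open Scope classical_set_scope.
Local Open Scope ring_scope.

(** Testing both steps of the scheme with their own unknown removes the
    nonlinearity: [w x u] is orthogonal to [u], the pressure is tested against a
    discretely divergence-free field, and the convective form [bstar] is
    skew-symmetric. What remains is an energy identity, in which the matrix G is
    made for turning the BDF2 difference into a telescoping G-norm plus a square
    ([Gform_telescope]). Young's inequality absorbs the forcing in half of the
    viscous term, and the Poincare inequality trades part of the other half for
    a fraction [alpha] of the G-norm, so that the energy contracts by
    [1 / (1 + alpha)] at every step up to a constant ([bdf2_decay]).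

    The estimates only lose when [Cl] decreases, so [Cl] can be chosen from the
    Poincare constant [(2 * pi) ^+ 2] alone, and [Cu = 4] is large enough. Since
    [u] and [w] share the same energy inequality, they are handled by one
    statement about sequences in a space with a semi-inner product.

    The analysis behind it concerns H1 of the torus, defined as a closure of
    smooth functions. The Poincare inequality ([poincare_H1]) is proved for
    smooth functions by integrating squared differences over pairs of points,
    and passes to the limit. The skew-symmetry of [bstar] ([bstar_cancel]) is the
    vanishing of the integral of a derivative of [u * w ^+ 2]. Its trilinear
    terms are controlled by the boundedness of [w], a piecewise polynomial on a
    mesh whose open triangles cover the square up to finitely many lines
    ([piecewise_poly_ae_bounded]); a limit in [w], then one in [u], reduces it
    to smooth functions ([trilinear_cancel]). *)

Set Implicit Arguments.
Unset Strict Implicit.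
Unset Printing Implicit Defensive.

(** * G-stability of BDF2 in an inner product space *)

(** The pairings [sip] and [vip] are bilinear only on square integrable fields,
    and vanish on fields that are zero almost everywhere; relativising to a
    subspace [S] and asking for mere nonnegativity covers both at once. *)
Definition semi_inner (R : realType) (V : lmodType R) (S : set V)
    (ip : V -> V -> R) : Prop :=
  [/\ linear_subspace S,
      forall x y, S x -> S y -> ip x y = ip y x,
      forall a x y z, S x -> S y -> S z ->
        ip (a *: x + y) z = a * ip x z + ip y z &
      forall x, S x -> 0 <= ip x x].

Section SemiInner.
Variables (R : realType) (V : lmodType R) (S : set V) (ip : V -> V -> R).
Hypothesis ipP : semi_inner S ip.

Lemma subspaceD x y : S x -> S y -> S (x + y).
Proof. by case: ipP => -[_ h] _ _ _ Sx Sy; rewrite -[x]scale1r; exact: h. Qed.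

Lemma subspaceZ a x : S x -> S (a *: x).
Proof. by case: ipP => -[S0 h] _ _ _ Sx; rewrite -[_ *: x]addr0; exact: h. Qed.

Lemma subspaceB x y : S x -> S y -> S (x - y).
Proof.
by move=> Sx Sy; rewrite -scaleN1r; apply: subspaceD => //; exact: subspaceZ.
Qed.

Lemma ipC x y : S x -> S y -> ip x y = ip y x.
Proof. by case: ipP => _ h _ _; exact: h. Qed.

Lemma ip_ge0 x : S x -> 0 <= ip x x.
Proof. by case: ipP => _ _ _ h; exact: h. Qed.

Lemma ipDl x y z : S x -> S y -> S z -> ip (x + y) z = ip x z + ip y z.
Proof.
case: ipP => _ _ h _ Sx Sy Sz.
by have := h 1 x y z Sx Sy Sz; rewrite scale1r mul1r.
Qed.

Lemma ipZl a x z : S x -> S z -> ip (a *: x) z = a * ip x z.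
Proof.
case: ipP => -[S0 _] _ h _ Sx Sz.
have := h a x 0 z Sx S0 Sz; rewrite addr0 => ->.
have := h 1 0 0 z S0 S0 Sz; rewrite scale1r addr0 mul1r => e0.
have -> : ip 0 z = 0 by apply: (addrI (ip 0 z)); rewrite -e0 addr0.
by rewrite addr0.
Qed.

Lemma ipDr x y z : S x -> S y -> S z -> ip z (x + y) = ip z x + ip z y.
Proof.
move=> Sx Sy Sz.
by rewrite ipC ?ipDl// 1?[ip x z]ipC 1?[ip y z]ipC//; exact: subspaceD.
Qed.

Lemma ipZr a x z : S x -> S z -> ip z (a *: x) = a * ip z x.
Proof.
by move=> Sx Sz; rewrite ipC ?ipZl// 1?[ip x z]ipC//; exact: subspaceZ.
Qed.

Lemma ipBl x y z : S x -> S y -> S z -> ip (x - y) z = ip x z - ip y z.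
Proof.
move=> Sx Sy Sz; rewrite -scaleN1r ipDl ?ipZl//; last exact: subspaceZ.
by rewrite mulN1r.
Qed.

Lemma ipBr x y z : S x -> S y -> S z -> ip z (x - y) = ip z x - ip z y.
Proof.
move=> Sx Sy Sz; rewrite -scaleN1r ipDr ?ipZr//; last exact: subspaceZ.
by rewrite mulN1r.
Qed.

Lemma ip_sqB x y t : S x -> S y ->
  ip (x - t *: y) (x - t *: y) = ip x x - 2 * t * ip x y + t ^+ 2 * ip y y.
Proof.
move=> Sx Sy; have Sty := subspaceZ t Sy; have Sxy := subspaceB Sx Sty.
rewrite ipBl// !ipBr// !ipZr// !ipZl// (ipC Sy Sx); ring.
Qed.

Lemma ip_cauchy_schwarz x y : S x -> S y -> ip x y ^+ 2 <= ip x x * ip y y.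
Proof.
move=> Sx Sy.
have [y0|yn0] := eqVneq (ip y y) 0.
- rewrite y0 mulr0.
  have h t : 0 <= ip x x - 2 * t * ip x y.
    have := ip_ge0 (subspaceB Sx (subspaceZ t Sy)).
    by rewrite ip_sqB// y0 mulr0 addr0.
  have [->|xyn0] := eqVneq (ip x y) 0; first by rewrite expr0n.
  have := h ((ip x x + 1) / (2 * ip x y)).
  have -> : 2 * ((ip x x + 1) / (2 * ip x y)) * ip x y = ip x x + 1 by field.
  by move=> h'; exfalso; move: h'; lra.
- have yp : 0 < ip y y by rewrite lt_def yn0 ip_ge0.
  have := ip_ge0 (subspaceB Sx (subspaceZ (ip x y / ip y y) Sy)).
  rewrite ip_sqB// -(pmulr_lge0 _ yp).
  have -> : (ip x x - 2 * (ip x y / ip y y) * ip x y +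
     (ip x y / ip y y) ^+ 2 * ip y y) * ip y y = ip x x * ip y y - ip x y ^+ 2.
    by field.
  by rewrite subr_ge0.
Qed.

(** The square of the G-norm of the pair [(x, y)], older vector first. *)
Definition Gform (x y : V) : R :=
  1 / 2 * ip x x - 2 * ip x y + 5 / 2 * ip y y.

(** The two eigenvalues of G are [3 / 2 - sqrt 2] and [3 / 2 + sqrt 2]; the
    rational bounds 1 / 16 and 4 of this lemma and the next enclose them. *)
Lemma Gform_le x y : S x -> S y -> Gform x y <= 4 * (ip x x + ip y y).
Proof.
move=> Sx Sy; have := ip_ge0 (subspaceB Sx (subspaceZ (-1) Sy)).
have := ip_ge0 Sx; have := ip_ge0 Sy.
by rewrite ip_sqB// /Gform; lra.
Qed.

Lemma Gform_ge x y : S x -> S y -> ip x x + ip y y <= 16 * Gform x y.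
Proof.
move=> Sx Sy; have := ip_ge0 (subspaceB Sx (subspaceZ (16 / 7) Sy)).
have := ip_ge0 Sx; have := ip_ge0 Sy.
by rewrite ip_sqB// /Gform; nra.
Qed.

(** The scheme starts from equal values at times -1 and 0, so this turns the
    initial G-norm into a plain norm. *)
Lemma Gform_diag x : Gform x x = ip x x.
Proof. by rewrite /Gform; field. Qed.

(** The G-stability of BDF2: the two sides differ by half the square of
    [z - 2 y + x]. *)
Lemma Gform_telescope x y z : S x -> S y -> S z ->
  Gform y z - Gform x y <= ip (3%:R *: z - 4%:R *: y + x) z.
Proof.
move=> Sx Sy Sz.
have S3 := subspaceZ 3%:R Sz; have S4 := subspaceZ 4%:R Sy.
have S34 := subspaceB S3 S4.
rewrite ipDl// ipBl// !ipZl//.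
have S2 := subspaceZ 2 Sy; have Sz2 := subspaceB Sz S2.
have := ip_ge0 (subspaceB Sz2 (subspaceZ (-1) Sx)).
rewrite ip_sqB// ip_sqB// ipBl// ipZl// /Gform.
rewrite (ipC Sx Sy) (ipC Sy Sz) (ipC Sx Sz).
by lra.
Qed.

Lemma G_equivalence_ip (Cl : R) (chi : 'I_2 -> V) :
  0 <= Cl <= 1 / 2 -> (forall i, S (chi i)) ->
  Cl * Gnorm ip chi <= pairnorm ip chi <= 4 * Gnorm ip chi.
Proof.
move=> /andP[Cl0 Cl1] Schi; rewrite /Gnorm /pairnorm.
set G := \sum_i _; set N := \sum_i ip (chi i) (chi i).
pose x := chi ord0; pose y := chi (lift ord0 ord0).
have Sx : S x by exact: Schi.
have Sy : S y by exact: Schi.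
have eN : N = ip x x + ip y y by rewrite /N !big_ord_recl big_ord0 addr0.
have eG : G = Gform x y.
  rewrite /G !big_ord_recl !big_ord0 !addr0 !mxE/= -/x -/y.
  rewrite !ipDr ?ipZr ?(ipC Sy Sx)//; try exact: subspaceZ.
  by rewrite /Gform; field.
have G4 := Gform_le Sx Sy; have G16 := Gform_ge Sx Sy.
have N0 : 0 <= N by rewrite eN addr_ge0// ip_ge0.
apply/andP; split.
- have {1}-> : Cl = Num.sqrt (Cl ^+ 2) by rewrite sqrtr_sqr ger0_norm.
  rewrite -sqrtrM ?sqr_ge0//; apply: ler_wsqrtr; rewrite eG eN.
  rewrite eN in N0; have G0 : 0 <= Gform x y by lra.
  have Cl4 : Cl ^+ 2 <= 1 / 4 by rewrite expr2; nra.
  by have := ler_wpM2r G0 Cl4; lra.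
- rewrite (_ : 4 = Num.sqrt (16 : R)); last first.
    by rewrite (_ : 16 = 4 ^+ 2) ?sqrtr_sqr ?ger0_norm//; rewrite expr2; lra.
  by rewrite -sqrtrM//; apply: ler_wsqrtr; rewrite eG eN.
Qed.

Lemma geometric_bound (K a : R) (E : nat -> R) :
  0 < a -> 0 <= K -> (forall n, (1 + a) * E n.+1 <= E n + K) ->
  forall n, E n <= (1 / (1 + a)) ^+ n * E 0%N + K / a.
Proof.
move=> a0 K0 h; elim=> [|n IH].
  by rewrite expr0 mul1r lerDl divr_ge0// ltW.
have a1 : 0 < 1 + a by rewrite addr_gt0.
rewrite -(ler_pM2l a1); apply: (le_trans (h n)).
have -> : (1 + a) * ((1 / (1 + a)) ^+ n.+1 * E 0%N + K / a) =
  (1 / (1 + a)) ^+ n * E 0%N + K / a + K.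
  rewrite exprS; field; by rewrite !gt_eqF.
by rewrite lerD2r.
Qed.

(** Adding [nu dt / 4 * g n] to both sides of the energy inequality leaves
    enough dissipation on the left to absorb [alpha] times the whole energy:
    the terms [nu dt / 4 * (g n + g n.+1)] dominate [alpha] times the G-norm
    through the Poincare inequality (this is where [4 * Cl ^+ 2 * CP <= 1]
    enters), and the remaining [nu dt / 2 * g n.+1] dominates [alpha] times the
    gradient part because [alpha <= 1 / 2]. The forcing then contributes a
    geometric series, of sum [dt / alpha * nu^-1 * F ^+ 2]; [dt / alpha] is the
    maximum of the conclusion. *)
Lemma bdf2_decay (nu dt Cl CP F : R) (v : nat -> V) (g : nat -> R) :
  0 < nu -> 0 < dt -> 0 < Cl -> 0 < CP ->
  Cl <= 1 / 4 -> 4 * Cl ^+ 2 * CP <= 1 ->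
  (forall n, S (v n)) -> (forall n, 0 <= g n) ->
  (forall n, ip (v n) (v n) <= CP * g n) ->
  (forall n, 1 / (2 * dt) * ip (3%:R *: v n.+1 - 4%:R *: v n + v n.-1) (v n.+1)
     + nu * g n.+1 <= nu / 2 * g n.+1 + (2 * nu)^-1 * F ^+ 2) ->
  let alpha := Num.min (1 / 2) (nu * dt * Cl ^+ 2 / 4) in
  forall n, Cl ^+ 2 * (ip (v n) (v n) + ip (v n.-1) (v n.-1)) + nu * dt / 4 * g n
    <= (1 / (1 + alpha)) ^+ n * (ip (v 0%N) (v 0%N) + nu * dt / 4 * g 0%N)
       + Num.max (2 * dt) (4 / (nu * Cl ^+ 2)) * nu^-1 * F ^+ 2.
Proof.
move=> nu0 dt0 Cl0 CP0 Cl1 ClCP Sv g0 poinc scheme alpha n.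
have nudt : 0 < nu * dt by rewrite mulr_gt0.
have Cl20 : 0 < Cl ^+ 2 by rewrite exprn_gt0.
have a0 : 0 < alpha by rewrite lt_min; apply/andP; split; nra.
have a1 : alpha <= 1 / 2 by rewrite ge_min lexx.
have a2 : alpha <= nu * dt * Cl ^+ 2 / 4 by rewrite ge_min lexx orbT.
pose E k := Gform (v k.-1) (v k) + nu * dt / 4 * g k.
pose K := dt / nu * F ^+ 2.
have K0 : 0 <= K by rewrite mulr_ge0 ?sqr_ge0// divr_ge0 ?ltW.
have step k : (1 + alpha) * E k.+1 <= E k + K.
  have := Gform_telescope (Sv k.-1) (Sv k) (Sv k.+1).
  have := scheme k; set s := ip _ _; rewrite /E /K /=.
  set G1 := Gform (v k) _; set G0 := Gform _ (v k).
  move=> sch tel.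
  have energy : G1 - G0 + nu * dt * g k.+1 <= dt / nu * F ^+ 2.
    have : s + nu * dt * g k.+1 <= dt / nu * F ^+ 2.
      have e : s = 2 * dt * (1 / (2 * dt) * s) by field; rewrite gt_eqF.
      have e2 : dt / nu * F ^+ 2 = 2 * dt * ((2 * nu)^-1 * F ^+ 2).
        by field; rewrite gt_eqF.
      rewrite e e2; move: sch; set p := 1 / (2 * dt) * s; set q := _ * F ^+ 2.
      by move=> sch; nra.
    by lra.
  have G1le : alpha * G1 <= nu * dt / 4 * (g k + g k.+1).
    have h1 := Gform_le (Sv k) (Sv k.+1).
    have h2 := Gform_ge (Sv k) (Sv k.+1).
    have p1 := poinc k; have p2 := poinc k.+1.
    have i1 := ip_ge0 (Sv k); have i2 := ip_ge0 (Sv k.+1).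
    have G10 : 0 <= G1 by rewrite /G1; lra.
    apply: (le_trans (ler_wpM2r G10 a2)).
    have : Cl ^+ 2 * G1 <= g k + g k.+1.
      have h3 : G1 <= 4 * CP * (g k + g k.+1) by rewrite /G1; lra.
      apply: (le_trans (ler_wpM2l (ltW Cl20) h3)).
      rewrite (_ : Cl ^+ 2 * _ = 4 * Cl ^+ 2 * CP * (g k + g k.+1)); last by ring.
      by apply: ler_piMl => //; exact: addr_ge0.
    move=> h; have := ler_wpM2l (ltW nudt) h; rewrite !mulrA; lra.
  have gg : alpha * (nu * dt / 4 * g k.+1) <= nu * dt / 2 * g k.+1.
    have : 0 <= nu * dt / 4 * g k.+1 by rewrite mulr_ge0// divr_ge0// ltW.
    by move=> h; have := ler_wpM2r h a1; lra.
  rewrite mulrDl mul1r mulrDr.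
  by move: energy G1le gg; rewrite !mulrA; lra.
have := geometric_bound a0 K0 step n.
rewrite {2}/E Gform_diag => h; apply: le_trans; last first.
  apply: (le_trans h); rewrite lerD2l.
  have -> : K / alpha = dt / alpha * nu^-1 * F ^+ 2.
    by rewrite /K; field; rewrite !gt_eqF.
  rewrite -mulrA -[leRHS]mulrA; apply: ler_wpM2r.
    by rewrite mulr_ge0 ?sqr_ge0// invr_ge0 ltW.
  rewrite /alpha; case: (leP (1/2) (nu * dt * Cl ^+ 2 / 4)) => _.
    rewrite le_max; apply/orP; left; rewrite le_eqVlt; apply/orP; left.
    by apply/eqP; field.
  rewrite le_max; apply/orP; right; rewrite le_eqVlt; apply/orP; left.
  by apply/eqP; field; rewrite !gt_eqF.
rewrite lerD2r.
have h1 := Gform_ge (Sv n.-1) (Sv n).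
have i1 := ip_ge0 (Sv n); have i2 := ip_ge0 (Sv n.-1).
have c16 : Cl ^+ 2 <= 1 / 16 by rewrite expr2; nra.
apply: (@le_trans _ _ (1 / 16 * (ip (v n) (v n) + ip (v n.-1) (v n.-1))));
  last by lra.
by rewrite ler_wpM2r// addr_ge0.
Qed.

End SemiInner.

(** * Square integrable fields on the periodic square *)

Section L2.
Variable R : realType.
Local Notation L := (2 * @pi R).
Local Notation Om := (@Omega R).
Local Notation mu := (@leb2 R).

Lemma period_gt0 : 0 < L.
Proof. by rewrite mulr_gt0// pi_gt0. Qed.

Lemma measurable_Omega : measurable Om.
Proof. by apply: measurableX; exact: measurable_itv. Qed.
Hint Resolve measurable_Omega : core.

Lemma leb2_Omega : mu Om = (L ^+ 2)%:E.
Proof.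
have e : (@lebesgue_measure R) (`]0, L[ : set R) = L%:E.
  by rewrite lebesgue_measure_itv/= lte_fin period_gt0 oppr0 adde0.
rewrite /leb2 /Omega product_measure1E//; try exact: measurable_itv.
by rewrite [X in (X * X)%E]e -EFinM expr2.
Qed.

Lemma integrable_mul (u v : sfield R) : L2 u -> L2 v ->
  mu.-integrable Om (EFin \o (fun x => u x * v x)).
Proof.
move=> [mu_ iu] [mv iv].
apply: (le_integrable measurable_Omega _ _
  (integrableD measurable_Omega iu iv)).
- by apply/measurable_EFinP; exact: measurable_funM.
- move=> x _ /=; rewrite lee_fin.
  rewrite (ger0_norm (addr_ge0 (sqr_ge0 _) (sqr_ge0 _))) ler_norml.
  have := sqr_ge0 (u x - v x); have := sqr_ge0 (u x + v x).
  have := sqr_ge0 (u x); have := sqr_ge0 (v x); rewrite !expr2; nra.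
Qed.

Lemma L2_combination a (u v : sfield R) : L2 u -> L2 v -> L2 (a *: u + v).
Proof.
move=> Lu Lv; have [mu_ iu] := Lu; have [mv iv] := Lv.
have mau : measurable_fun Om (a *: u + v).
  apply: measurable_funD => //; exact: measurable_funM.
split => //.
have e : (fun x => (((a *: u + v) x) ^+ 2)%:E) =
   ((fun x => (a ^+ 2)%:E * (u x ^+ 2)%:E) \+
    ((fun x => (2 * a)%:E * (u x * v x)%:E) \+ (fun x => (v x ^+ 2)%:E)))%E.
  apply/funext => x; rewrite /= -!EFinM -!EFinD; congr EFin.
  by rewrite [(a *: u + v) x](_ : _ = a * u x + v x)//; ring.
rewrite e; apply: integrableD => //; first exact: integrableZl.
apply: integrableD => //; apply: integrableZl => //; exact: integrable_mul.
Qed.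

Lemma L2_0 : L2 (0 : sfield R).
Proof.
split; first exact: measurable_cst.
rewrite (_ : (fun x => _) = cst 0%E); first exact: integrable0.
by apply/funext => x; rewrite /= expr0n.
Qed.

Lemma sip_semi_inner : semi_inner (@L2 R) (@sip R).
Proof.
split.
- by split; [exact: L2_0|move=> *; exact: L2_combination].
- by move=> x y _ _; apply: eq_Rintegral => z _; rewrite mulrC.
- move=> a x y z Lx Ly Lz; rewrite /sip -RintegralZl//; last exact: integrable_mul.
  rewrite -RintegralD//; last 2 first.
    exact: (integrableZl measurable_Omega a (integrable_mul Lx Lz)).
    exact: integrable_mul.
  by apply: eq_Rintegral => t _; rewrite mulrA -mulrDl.
- by move=> x _; apply: Rintegral_ge0 => t _; exact: sqr_ge0.
Qed.

Lemma vip_semi_inner : semi_inner (@vL2 R) (@vip R).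
Proof.
have [[S0 SS] sC sD s0] := sip_semi_inner.
split.
- by split=> // a u v [? ?] [? ?]; split; exact: SS.
- by move=> x y [? ?] [? ?]; congr (_ + _); exact: sC.
- move=> a x y z [? ?] [? ?] [? ?]; rewrite /vip sD// sD//; ring.
- by move=> x [? ?]; apply: addr_ge0; exact: s0.
Qed.

Lemma snorm_ge0 (u : sfield R) : 0 <= snorm u.
Proof. exact: sqrtr_ge0. Qed.

Lemma sqr_snorm (u : sfield R) : L2 u -> snorm u ^+ 2 = sip u u.
Proof. by move=> Lu; rewrite sqr_sqrtr//; exact: (ip_ge0 sip_semi_inner). Qed.

Lemma sqr_vnorm (v : vfield R) : vL2 v -> vnorm v ^+ 2 = vip v v.
Proof. by move=> Lv; rewrite sqr_sqrtr//; exact: (ip_ge0 vip_semi_inner). Qed.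

Lemma le_abs_sip (u v : sfield R) : L2 u -> L2 v ->
  `|sip u v| <= snorm u * snorm v.
Proof.
move=> Lu Lv; rewrite -ler_sqr ?nnegrE ?mulr_ge0 ?snorm_ge0//.
rewrite real_normK ?num_real// exprMn !sqr_snorm//.
exact: (ip_cauchy_schwarz sip_semi_inner).
Qed.

Definition L2cvg (phi : nat -> sfield R) (u : sfield R) :=
  (fun k => snorm (phi k - u)) @ \oo --> (0 : R).

Lemma L2B (u v : sfield R) : L2 u -> L2 v -> L2 (u - v).
Proof. by move=> Lu Lv; exact: (subspaceB sip_semi_inner). Qed.

Lemma sip_cvg (p q : nat -> sfield R) (u v : sfield R) :
  (forall k, L2 (p k)) -> (forall k, L2 (q k)) -> L2 u -> L2 v ->
  L2cvg p u -> L2cvg q v -> (fun k => sip (p k) (q k)) @ \oo --> sip u v.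
Proof.
move=> Lp Lq Lu Lv cp cq.
pose e k := snorm (p k - u) * snorm (q k - v) + snorm (p k - u) * snorm v
  + snorm u * snorm (q k - v).
have e0 : e @ \oo --> (0 : R).
  rewrite (_ : 0 = 0 * 0 + 0 * snorm v + snorm u * 0); last first.
    by rewrite !(mul0r, mulr0) !addr0.
  apply: cvgD; first by apply: cvgD; [exact: cvgM|apply: cvgMr_tmp].
  exact: cvgMl_tmp.
have ple k : sip u v - e k <= sip (p k) (q k) <= sip u v + e k.
  have Lpu := L2B (Lp k) Lu; have Lqv := L2B (Lq k) Lv.
  have -> : sip (p k) (q k) = sip u v + sip (p k - u) (q k - v)
      + sip (p k - u) v + sip u (q k - v).
    have S := sip_semi_inner; rewrite (ipBr S)// !(ipBl S)// (ipBr S)//; ring.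
  have := le_abs_sip Lpu Lqv; have := le_abs_sip Lpu Lv.
  have := le_abs_sip Lu Lqv.
  rewrite !ler_norml /e => /andP[? ?] /andP[? ?] /andP[? ?]; apply/andP; split; lra.
apply: (@squeeze_cvgr _ _ _ _ (fun k => sip u v - e k)
  (fun k => sip u v + e k)).
- by near=> k; exact: ple.
- by rewrite -[X in _ --> X]subr0; apply: cvgB => //; exact: cvg_cst.
- by rewrite -[X in _ --> X]addr0; apply: cvgD => //; exact: cvg_cst.
Unshelve. all: by end_near. Qed.

Definition ae_bounded (w : sfield R) (M : R) : Prop :=
  {ae mu, forall x, Om x -> `|w x| <= M}.

Lemma L2_mul_bounded (w g : sfield R) M :
  measurable_fun Om w -> ae_bounded w M -> L2 g ->
  L2 (fun x => w x * g x) /\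
  sip (fun x => w x * g x) (fun x => w x * g x) <= M ^+ 2 * sip g g.
Proof.
move=> mw bw Lg; have [mg ig] := Lg.
have mwg : measurable_fun Om (fun x => w x * g x) by exact: measurable_funM.
have ig2 : mu.-integrable Om (fun x => (M ^+ 2 * (g x ^+ 2))%:E).
  exact: (integrableZl measurable_Omega (M ^+ 2) ig).
have le : (\int[mu]_(x in Om) ((w x * g x) ^+ 2)%:E <=
    \int[mu]_(x in Om) (M ^+ 2 * (g x ^+ 2))%:E)%E.
  apply: ae_ge0_le_integral => //.
  - by move=> x _; rewrite lee_fin sqr_ge0.
  - by apply/measurable_EFinP; exact: measurable_funX.
  - by move=> x _; rewrite lee_fin mulr_ge0// sqr_ge0.
  - exact: (measurable_int _ ig2).
  - apply: filterS bw => x bx Ox; rewrite lee_fin exprMn ler_wpM2r ?sqr_ge0//.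
    rewrite -[w x ^+ 2]real_normK ?num_real// lerXn2r ?nnegrE//; last exact: bx.
    by apply: le_trans (bx Ox).
have fin2 : (\int[mu]_(x in Om) (M ^+ 2 * (g x ^+ 2))%:E)%E \is a fin_num.
  exact: integrable_fin_num.
have ltoo : (\int[mu]_(x in Om) ((w x * g x) ^+ 2)%:E < +oo)%E.
  by apply: (le_lt_trans le); rewrite ltey_eq fin2.
have ge0 : (0 <= \int[mu]_(x in Om) ((w x * g x) ^+ 2)%:E)%E.
  by apply: integral_ge0 => x _; rewrite lee_fin sqr_ge0.
split.
- split => //; apply/integrableP; split.
    by apply/measurable_EFinP; exact: measurable_funX.
  under eq_integral => x _ do rewrite gee0_abs ?lee_fin ?sqr_ge0//.
  exact: ltoo.
- rewrite /sip -RintegralZl//.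
  apply: fine_le => //; by rewrite ge0_fin_numE.
Qed.

End L2.

(** * Continuous functions and iterated integrals *)

Section Plane.
Variable R : realType.
Local Notation L := (2 * @pi R).
Local Notation Om := (@Omega R).
Local Notation mu := (@leb2 R).
Local Notation leb := (@lebesgue_measure R).
Local Notation I := (`]0, (2 * @pi R)[%classic : set (measurableTypeR R)).
Local Notation plane2 := (measurableTypeR R * measurableTypeR R)%type.

(** The measurable sets of the plane are those of the product sigma-algebra; an
    open set belongs to it as the countable union of the rational open boxes
    that it contains. *)
Lemma open_measurable2 (U : set (R * R)) : open U -> measurable (U : set plane2).
Proof.
move=> oU.
pose box (q : (rat * rat) * (rat * rat)) : set plane2 :=
  `]ratr q.1.1, ratr q.1.2[ `*` `]ratr q.2.1, ratr q.2.2[.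
have -> : (U : set plane2) =
    \bigcup_(q in [set q | box q `<=` U]) box q.
  apply/seteqP; split => [[x y] Uxy|xy [q qU]]; last exact: qU.
  have /nbhs_ballP[e /= e0 be] := open_nbhs_nbhs (conj oU Uxy).
  have h (z : R) : exists2 q : rat * rat, z \in `]ratr q.1, ratr q.2[ &
      (forall t : R, t \in `]ratr q.1, ratr q.2[ -> `|z - t| < e).
    have [p] : exists p : rat, ratr p \in `]z - e, z[.
      by apply: rat_in_itvoo; rewrite ltrBlDr ltrDl.
    have [q] : exists q : rat, ratr q \in `]z, z + e[.
      by apply: rat_in_itvoo; rewrite ltrDl.
    rewrite !in_itv/= => /andP[zq qe] /andP[pe pz].
    exists (p, q) => /=.
      by rewrite in_itv/= pz zq.
    move=> t; rewrite in_itv/= => /andP[pt tq].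
    by rewrite ltr_norml; apply/andP; split; lra.
  have [p xp pe] := h x; have [q yq qe] := h y.
  have sub : box (p, q) `<=` U.
    by case=> s t [/= sp tq]; apply: be; split; [exact: pe|exact: qe].
  by exists (p, q).
rewrite bigcup_mkcond; apply: countable_bigcupT_measurable => [|q].
  exact: countableP.
case: ifP => _; last exact: measurable0.
by apply: measurableX; exact: measurable_itv.
Qed.

Lemma continuous_measurable2 (h : R * R -> R) (D : set plane2) :
  continuous h -> measurable_fun D (h : plane2 -> R).
Proof.
move=> ch; apply: measurable_funTS.
apply: (measurability _ (RGenOpens.measurableE R)).
move=> _ [_ [a [b ->] <-]]; rewrite setTI; apply: open_measurable2.
by move/continuousP : ch; apply; exact: interval_open.
Qed.

Lemma continuous_bounded_box (h : R * R -> R) : continuous h ->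
  exists2 M, 0 <= M &
    forall x y, x \in `[0, L] -> y \in `[0, L] -> `|h (x, y)| <= M.
Proof.
move=> ch.
have cK : compact ((`[0, L] : set R) `*` (`[0, L] : set R)).
  by apply: compact_setX; exact: segment_compact.
have /compact_bounded[M [_ hM]] :=
  continuous_compact (continuous_subspaceT ch) cK.
exists (`|M| + 1) => // x y xI yI; apply: (hM (`|M| + 1)).
  by rewrite (le_lt_trans (ler_norm _))// ltrDl.
by exists (x, y) => //; split.
Qed.

Lemma continuous_integrable_Omega (h : R * R -> R) :
  continuous h -> mu.-integrable Om (EFin \o h).
Proof.
move=> ch; have [M M0 hM] := continuous_bounded_box ch.
apply: measurable_bounded_integrable.
- exact: measurable_Omega.
- by rewrite [X in (X < _)%E]leb2_Omega ltry.
- exact: continuous_measurable2.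
- exists M; split; first exact: num_real.
  move=> N MN [x y] [/= xI yI]; apply: le_trans (ltW MN); apply: hM.
    exact: subset_itv_oo_cc.
  exact: subset_itv_oo_cc.
Qed.

Lemma continuous_L2 (h : R * R -> R) : continuous h -> L2 h.
Proof.
move=> ch; split; first exact: continuous_measurable2.
apply: (@continuous_integrable_Omega (fun x => h x ^+ 2)) => x.
exact: (continuousM (ch x) (ch x)).
Qed.

Lemma continuous_integrable_I (F : R -> R) :
  continuous F -> leb.-integrable I (EFin \o F).
Proof.
move=> cF; have iF : leb.-integrable `[0, L] (EFin \o F).
  apply: continuous_compact_integrable; first exact: segment_compact.
  exact: continuous_subspaceT.
apply: integrableS iF; [exact: measurable_itv|exact: measurable_itv|].
exact: subset_itv_oo_cc.
Qed.

Lemma continuous_slice (h : R * R -> R) x :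
  continuous h -> continuous (fun y => h (x, y)).
Proof.
move=> ch y.
apply: (@continuous_comp _ _ _ (fun y : R => (x, y)) h); last exact: ch.
exact: (cvg_pair (cvg_cst x) cvg_id).
Qed.

Lemma continuous_flip (h : R * R -> R) :
  continuous h -> continuous (fun x => h (x.2, x.1)).
Proof.
move=> ch x.
apply: (@continuous_comp _ _ _ (fun x : R * R => (x.2, x.1)) h); last exact: ch.
exact: (cvg_pair (@cvg_snd _ _ _ _ _) (@cvg_fst _ _ _ _ _)).
Qed.

(** Extending [h] by zero outside the square turns integrals over the square
    into integrals over the plane, where Fubini's theorem applies. *)
Lemma fubini_restrict (h : R * R -> R) x : continuous h ->
  (\int[leb]_y ((EFin \o h) \_ Om) (x, y) =
   ((fun x => (\int[leb]_(y in I) h (x, y))%:E) \_ I) x)%E.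
Proof.
move=> ch; rewrite /patch; case: ifPn => xI.
- rewrite /Rintegral fineK; last first.
    apply: integrable_fin_num; first exact: measurable_itv.
    by apply: continuous_integrable_I; exact: continuous_slice.
  rewrite [RHS]integral_mkcond; apply: eq_integral => y _; rewrite /patch.
  congr (if _ then _ else _); rewrite inE in xI.
  apply/idP/idP => [/set_mem[_ yI]|/set_mem yI]; apply: mem_set => //.
- rewrite integral0_eq// => y _; case: ifPn => //; rewrite inE => -[/= xI' _].
  by rewrite mem_set in xI.
Qed.

Lemma fubini_Omega (h : R * R -> R) : continuous h ->
  leb.-integrable I (EFin \o (fun x => \int[leb]_(y in I) h (x, y))) /\
  \int[mu]_(z in Om) h z = \int[leb]_(x in I) \int[leb]_(y in I) h (x, y).
Proof.
move=> ch; have ih := continuous_integrable_Omega ch.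
have ih' : mu.-integrable setT ((EFin \o h) \_ Om).
  exact: (integrable_mkcond (mu:=mu) (EFin \o h)
    (measurable_Omega (R:=R))).1 ih.
have e : fubini_F leb ((EFin \o h) \_ Om) =
    (fun x => (\int[leb]_(y in I) h (x, y))%:E) \_ I.
  by apply/funext => x; rewrite /fubini_F fubini_restrict.
split.
- apply: (integrable_mkcond (mu:=leb) (D:=I)
    (EFin \o (fun x => \int[leb]_(y in I) h (x, y))) (measurable_itv _)).2.
  by have := integrable_fubini_F ih'; rewrite e.
- rewrite /Rintegral integral_mkcond -(integral12_prod_meas1 ih') e.
  by rewrite -integral_mkcond.
Qed.

(** Symmetry of the square: results on slices along the second coordinate carry
    over to the first one. *)
Lemma flip_Omega (h : R * R -> R) : continuous h ->
  \int[mu]_(z in Om) h (z.2, z.1) = \int[mu]_(z in Om) h z.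
Proof.
move=> ch; have ih := continuous_integrable_Omega ch.
have ih' : mu.-integrable setT ((EFin \o h) \_ Om).
  exact: (integrable_mkcond (mu:=mu) (EFin \o h)
    (measurable_Omega (R:=R))).1 ih.
rewrite (fubini_Omega (continuous_flip ch)).2 /=.
rewrite [RHS]/Rintegral integral_mkcond -(integral21_prod_meas1 ih') /Rintegral.
rewrite integral_mkcond; congr fine; apply: eq_integral => x _.
rewrite -(fubini_restrict x (continuous_flip ch)) /fubini_G.
apply: eq_integral => y _; rewrite /patch /=.
by congr (if _ then _ else _); apply/idP/idP; rewrite !inE => -[/= ? ?]; split.
Qed.

End Plane.

(** * Integrals of derivatives and the Poincare inequality for smooth functions *)

Section Calculus.
Variable R : realType.
Local Notation L := (2 * @pi R).
Local Notation Om := (@Omega R).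
Local Notation mu := (@leb2 R).
Local Notation leb := (@lebesgue_measure R).
Local Notation I := (`]0, (2 * @pi R)[%classic : set (measurableTypeR R)).

Lemma leb_I : leb I = L%:E.
Proof. by rewrite lebesgue_measure_itv/= lte_fin period_gt0 oppr0 adde0. Qed.

Lemma Rintegral_cst_I (c : R) : \int[leb]_(x in I) c = c * L.
Proof.
have mI : measurable I by exact: measurable_itv.
by rewrite Rintegral_cst//= [X in fine X]leb_I.
Qed.

Lemma continuous_derivable_FTC (F F' : R -> R) a b :
  (forall t : R, is_derive t 1 F (F' t)) -> continuous F' -> a < b ->
  \int[leb]_(t in `[a, b]) F' t = F b - F a.
Proof.
move=> dF cF' ab; rewrite /Rintegral.
have cF t : {for t, continuous F}.
  apply: differentiable_continuous; rewrite -derivable1_diffP.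
  exact: ex_derive.
rewrite (continuous_FTC2 ab (continuous_subspaceT cF') (F := F))//.
- split.
  + by move=> x _; exact: ex_derive.
  + by apply: cvg_at_right_filter; exact: cF.
  + by apply: cvg_at_left_filter; exact: cF.
- by move=> x _; rewrite derive1E derive_val.
Qed.

(** The fundamental theorem of calculus followed by the Cauchy-Schwarz
    inequality on [[s, t]]. *)
Lemma oscillation_bound (F F' : R -> R) s t :
  (forall t : R, is_derive t 1 F (F' t)) -> continuous F' ->
  s \in `]0, L[ -> t \in `]0, L[ ->
  (F s - F t) ^+ 2 <= L * \int[leb]_(r in I) F' r ^+ 2.
Proof.
move=> dF cF'; have ci2 : continuous (fun r => F' r ^+ 2).
  by move=> r; exact: (continuousM (cF' r) (cF' r)).
have int0 : 0 <= \int[leb]_(r in I) F' r ^+ 2.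
  by apply: Rintegral_ge0 => r _; exact: sqr_ge0.
have L0 := period_gt0 R.
wlog st : s t / s < t.
  move=> W sI tI; case: (ltgtP s t) => [st|ts|->]; first exact: W.
    by rewrite -sqrrN opprB; exact: W.
  by rewrite subrr expr0n mulr_ge0// ltW.
move=> sI tI; rewrite -sqrrN opprB -(continuous_derivable_FTC dF cF' st).
have mst : measurable (`[s, t]%classic : set (measurableTypeR R)).
  exact: measurable_itv.
have cpt : compact `[s, t] by exact: segment_compact.
have i1 : leb.-integrable `[s, t] (EFin \o F').
  by apply: continuous_compact_integrable => //; exact: continuous_subspaceT.
have i2 : leb.-integrable `[s, t] (EFin \o (fun r => F' r ^+ 2)).
  by apply: continuous_compact_integrable => //; exact: continuous_subspaceT.
set J := \int[leb]_(r in _) F' r.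
have mst' : leb `[s, t] = (t - s)%:E.
  by rewrite lebesgue_measure_itv/= lte_fin st -EFinB.
have ts0 : 0 < t - s by rewrite subr_gt0.
have cst_i c : leb.-integrable `[s, t] (EFin \o (fun=> c)).
  apply: continuous_compact_integrable => //.
  by apply: continuous_subspaceT => x; exact: cvg_cst.
(* The mean of [F'] on [[s, t]]: the variance of [F'] around it is nonnegative,
   which is the Cauchy-Schwarz inequality against the constant 1. *)
pose c := J / (t - s).
have pos : 0 <= \int[leb]_(r in `[s, t]) (F' r - c) ^+ 2.
  by apply: Rintegral_ge0 => r _; exact: sqr_ge0.
have ex : \int[leb]_(r in `[s, t]) (F' r - c) ^+ 2 =
    \int[leb]_(r in `[s, t]) F' r ^+ 2 - J ^+ 2 / (t - s).
  rewrite (_ : (fun r => (F' r - c) ^+ 2) =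
    (fun r => F' r ^+ 2 + (- (2 * c) * F' r + c ^+ 2))); last first.
    by apply/funext => r; ring.
  have i3 : leb.-integrable `[s, t] (EFin \o (fun r => - (2 * c) * F' r)).
    exact: (integrableZl mst (- (2 * c)) i1).
  rewrite RintegralD//; last exact: (integrableD mst i3 (cst_i (c ^+ 2))).
  rewrite RintegralD// RintegralZl// Rintegral_cst// [X in fine X]mst'/= -/J /c.
  by field; rewrite gt_eqF.
have J2 : J ^+ 2 <= (t - s) * \int[leb]_(r in `[s, t]) F' r ^+ 2.
  rewrite ex in pos; rewrite mulrC -ler_pdivrMr//; lra.
apply: (le_trans J2); apply: ler_pM.
- exact: ltW.
- by apply: Rintegral_ge0 => r _; exact: sqr_ge0.
- by move: sI tI; rewrite !in_itv/= => /andP[? ?] /andP[? ?]; lra.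
- have mI : measurable I by exact: measurable_itv.
  have iI : leb.-integrable I (EFin \o (fun r => F' r ^+ 2)).
    exact: continuous_integrable_I.
  apply: fine_le.
  + exact: integrable_fin_num.
  + exact: integrable_fin_num iI.
  + apply: ge0_subset_integral => //.
    * exact: (measurable_int _ iI).
    * by move=> r _; rewrite lee_fin sqr_ge0.
    * move=> r /=; move: sI tI.
      rewrite !in_itv/= => /andP[? ?] /andP[? ?] /andP[? ?].
      by apply/andP; split; lra.
Qed.

Local Notation flip h := (fun x : R * R => h (x.2, x.1)).

Definition slice_derivative (h dh : R * R -> R) :=
  forall x y : R, is_derive y 1 (fun y => h (x, y)) (dh (x, y)).

Lemma integral_derivative_periodic (h dh : R * R -> R) :
  slice_derivative h dh -> continuous dh ->
  (forall x, h (x, L) = h (x, 0)) -> \int[mu]_(z in Om) dh z = 0.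
Proof.
move=> sh cdh per; rewrite (fubini_Omega cdh).2.
rewrite (_ : (fun x => _) = (fun x => 0)) ?Rintegral_cst_I ?mul0r//.
apply/funext => x; have cs := continuous_slice (x:=x) cdh.
transitivity (h (x, L) - h (x, 0)); last by rewrite per subrr.
rewrite -(continuous_derivable_FTC (sh x) cs (period_gt0 R)).
have i : leb.-integrable `[0, L] (EFin \o (fun y => dh (x, y))).
  apply: continuous_compact_integrable; first exact: segment_compact.
  exact: continuous_subspaceT.
rewrite Rintegral_itv_obnd_cbnd ?Rintegral_itv_bndo_bndc//.
  apply: integrableS i; [exact: measurable_itv|exact: measurable_itv|].
  exact: subset_itv_co_cc.
exact: continuous_integrable_I.
Qed.

(** Twice the left-hand side is the integral of [(h p - h q) ^+ 2] over all
    pairs of points. Going from [p] to [q] along a horizontal and then a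
    vertical segment bounds this square by
    [2 * L * A p.2 + 2 * L * B q.1], where [A] and [B] are the integrals of
    [d1 ^+ 2] and [d2 ^+ 2] over a whole horizontal, resp. vertical, line.
    Integrating first in [p], then in [q], gives the right-hand side. *)
Lemma poincare_smooth (h d1 d2 : R * R -> R) :
  continuous h -> continuous d1 -> continuous d2 ->
  slice_derivative (flip h) (flip d1) -> slice_derivative h d2 ->
  L ^+ 2 * \int[mu]_(z in Om) h z ^+ 2 - (\int[mu]_(z in Om) h z) ^+ 2 <=
  L ^+ 4 * (\int[mu]_(z in Om) d1 z ^+ 2 + \int[mu]_(z in Om) d2 z ^+ 2).
Proof.
move=> ch c1 c2 s1 s2.
have csq (g : R * R -> R) : continuous g -> continuous (fun z => g z ^+ 2).
  by move=> cg z; exact: (continuousM (cg z) (cg z)).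
have L0 := period_gt0 R.
set S := \int[mu]_(z in Om) h z ^+ 2; set M := \int[mu]_(z in Om) h z.
set D1 := \int[mu]_(z in Om) d1 z ^+ 2; set D2 := \int[mu]_(z in Om) d2 z ^+ 2.
have [iA eA] := fubini_Omega (csq _ (continuous_flip c1)).
have [iB eB] := fubini_Omega (csq _ c2).
pose A y := \int[leb]_(x in I) d1 (x, y) ^+ 2.
pose B x := \int[leb]_(y in I) d2 (x, y) ^+ 2.
have {}eA : D1 = \int[leb]_(y in I) A y by rewrite -[LHS](flip_Omega (csq _ c1)).
have {}eB : D2 = \int[leb]_(x in I) B x by [].
have mI : measurable I by exact: measurable_itv.
have iI c : leb.-integrable I (EFin \o (fun=> c)).
  by apply: continuous_integrable_I => x; exact: cvg_cst.
have aff (C : R -> R) a b : leb.-integrable I (EFin \o C) ->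
    leb.-integrable I (EFin \o (fun x => a * C x + b)) /\
    \int[leb]_(x in I) (a * C x + b) = a * (\int[leb]_(x in I) C x) + b * L.
  move=> iC; have iaC : leb.-integrable I (EFin \o (fun x => a * C x)).
    exact: (integrableZl mI a iC).
  split; first exact: (integrableD mI iaC (iI b)).
  by rewrite RintegralD// RintegralZl// Rintegral_cst_I.
have osc x y x' y' : I x -> I y -> I x' -> I y' ->
    (h (x, y) - h (x', y')) ^+ 2 <= 2 * L * A y + 2 * L * B x'.
  move=> xI yI xI' yI'.
  have o1 := oscillation_bound (s1 y)
    (continuous_slice (x:=y) (continuous_flip c1)) xI xI'.
  have o2 := oscillation_bound (s2 x')
    (continuous_slice (x:=x') c2) yI yI'.
  rewrite /= -/(A y) in o1; rewrite -/(B x') in o2.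
  move: o1 o2; set a := h (x, y); set b := h (x', y); set c := h (x', y').
  have := sqr_ge0 ((a - b) - (b - c)); rewrite !expr2 => ? ? ?; nra.
(* The inner integral, over [p], as a function of [c = h q]. *)
pose K c := \int[mu]_(z in Om) (h z - c) ^+ 2.
have KE c : K c = S - 2 * c * M + L ^+ 2 * c ^+ 2.
  have ih := continuous_integrable_Omega ch.
  have ih2 := continuous_integrable_Omega (csq _ ch).
  have mO := @measurable_Omega R.
  rewrite /K (_ : (fun z => (h z - c) ^+ 2) =
    (fun z => h z ^+ 2 + ((- (2 * c)) * h z + c ^+ 2))); last first.
    by apply/funext => z; ring.
  have i3 : mu.-integrable Om (EFin \o (fun z => - (2 * c) * h z)).
    exact: (integrableZl mO (- (2 * c)) ih).
  have i4 : mu.-integrable Om (EFin \o (fun=> c ^+ 2)).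
    by apply: continuous_integrable_Omega => x; exact: cvg_cst.
  rewrite RintegralD//; last exact: (integrableD mO i3 i4).
  rewrite RintegralD// RintegralZl// Rintegral_cst//.
  by rewrite [X in fine X]leb2_Omega /= -/S -/M; ring.
have Kle x' y' : I x' -> I y' ->
    K (h (x', y')) <= 2 * L ^+ 2 * D1 + 2 * L ^+ 3 * B x'.
  move=> xI' yI'; set c := h (x', y').
  have chc : continuous (fun z => (h z - c) ^+ 2).
    by apply: (csq (fun z => h z - c)) => z; apply: cvgB; [exact: ch|exact: cvg_cst].
  rewrite /K -(flip_Omega chc).
  have [iK ->] := fubini_Omega (continuous_flip chc) => /=.
  have [iu eu] := aff A (2 * L ^+ 2) (2 * L ^+ 2 * B x') iA.
  apply: (@le_trans _ _
    (\int[leb]_(y in I) (2 * L ^+ 2 * A y + 2 * L ^+ 2 * B x'))).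
    apply: le_Rintegral => // y yI.
    have -> : 2 * L ^+ 2 * A y + 2 * L ^+ 2 * B x' =
       \int[leb]_(x in I) (2 * L * A y + 2 * L * B x').
      by rewrite Rintegral_cst_I; ring.
    apply: le_Rintegral => //.
      apply: continuous_integrable_I.
      exact: (continuous_slice (x:=y) (continuous_flip chc)).
    by move=> x xI; exact: osc.
  by rewrite eu -eA; rewrite le_eqVlt; apply/orP; left; apply/eqP; ring.
have cK : continuous (fun z => K (h z)).
  rewrite (_ : (fun z => _) =
    (fun z => S - 2 * h z * M + L ^+ 2 * h z ^+ 2)); last first.
    by apply/funext => z; exact: KE.
  move=> z; apply: cvgD.
    apply: cvgB; first exact: cvg_cst.
    by apply: cvgMr_tmp; apply: cvgMl_tmp; exact: ch.
  by apply: cvgMl_tmp; exact: csq.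
have intK : \int[mu]_(z in Om) K (h z) = 2 * L ^+ 2 * S - 2 * M ^+ 2.
  have ih := continuous_integrable_Omega ch.
  have ih2 := continuous_integrable_Omega (csq _ ch).
  have mO := @measurable_Omega R.
  rewrite (_ : (fun z => K (h z)) =
    (fun z => L ^+ 2 * h z ^+ 2 + ((- (2 * M)) * h z + S))); last first.
    by apply/funext => z; rewrite KE; ring.
  have i2 : mu.-integrable Om (EFin \o (fun z => L ^+ 2 * h z ^+ 2)).
    exact: (integrableZl mO (L ^+ 2) ih2).
  have i3 : mu.-integrable Om (EFin \o (fun z => - (2 * M) * h z)).
    exact: (integrableZl mO (- (2 * M)) ih).
  have i4 : mu.-integrable Om (EFin \o (fun=> S)).
    by apply: continuous_integrable_Omega => x; exact: cvg_cst.
  rewrite RintegralD//; last exact: (integrableD mO i3 i4).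
  rewrite RintegralD// RintegralZl// RintegralZl// Rintegral_cst//.
  by rewrite [X in fine X]leb2_Omega /= -/S -/M; ring.
have : \int[mu]_(z in Om) K (h z) <= 2 * L ^+ 4 * (D1 + D2).
  have [iK ->] := fubini_Omega cK.
  have [iu eu] := aff B (2 * L ^+ 4) (2 * L ^+ 3 * D1) iB.
  apply: (@le_trans _ _
    (\int[leb]_(x in I) (2 * L ^+ 4 * B x + 2 * L ^+ 3 * D1))).
    apply: le_Rintegral => // x xI.
    have -> : 2 * L ^+ 4 * B x + 2 * L ^+ 3 * D1 =
       \int[leb]_(y in I) (2 * L ^+ 2 * D1 + 2 * L ^+ 3 * B x).
      by rewrite Rintegral_cst_I; ring.
    apply: le_Rintegral => //.
      by apply: continuous_integrable_I; exact: (continuous_slice (x:=x) cK).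
    by move=> y yI; exact: Kle.
  by rewrite eu -eB; rewrite le_eqVlt; apply/orP; left; apply/eqP; ring.
rewrite intK; lra.
Qed.

End Calculus.

(** * Passage to the limit in H1 *)

Section Sobolev.
Variable R : realType.
Local Notation L := (2 * @pi R).
Local Notation Om := (@Omega R).
Local Notation mu := (@leb2 R).

(** [orient true] exchanges the two coordinates, so that statements about slices
    along the second coordinate serve for both partial derivatives. *)
Definition orient (b : bool) (h : R * R -> R) : R * R -> R :=
  if b then fun x => h (x.2, x.1) else h.

Definition periodic_C1 (b : bool) (h dh : R * R -> R) : Prop :=
  [/\ continuous h, continuous dh, Defs.periodic h &
      slice_derivative (orient b h) (orient b dh)].

Lemma periodic_C1_integral b h dh : periodic_C1 b h dh ->
  \int[mu]_(z in Om) dh z = 0.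
Proof.
case: b => -[_ cdh ph sh].
- rewrite -(flip_Omega cdh); apply: (integral_derivative_periodic sh) => [|x].
    exact: continuous_flip.
  by rewrite /= -[in LHS](add0r L); have [-> _] := ph (0, x).
- apply: (integral_derivative_periodic sh) => // x.
  by rewrite /= -[in LHS](add0r L); have [_ ->] := ph (x, 0).
Qed.

Lemma periodic_C1_mul b h dh k dk : periodic_C1 b h dh -> periodic_C1 b k dk ->
  periodic_C1 b (fun z => h z * k z) (fun z => dh z * k z + h z * dk z).
Proof.
move=> [ch cdh ph sh] [ck cdk pk sk]; split.
- by move=> z; exact: (continuousM (ch z) (ck z)).
- move=> z; apply: cvgD; first exact: (continuousM (cdh z) (ck z)).
  exact: (continuousM (ch z) (cdk z)).
- by move=> z; have [h1 h2] := ph z; have [k1 k2] := pk z; rewrite h1 h2 k1 k2.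
- move=> x y; have dM := is_deriveM (sh x y) (sk x y).
  have -> : (fun y => orient b (fun z => h z * k z) (x, y)) =
     (fun y => orient b h (x, y)) * (fun y => orient b k (x, y)).
    by apply/funext => t; case: (b).
  apply: is_derive_eq dM _.
  by case: (b) => /=; rewrite /GRing.scale/=; ring.
Qed.

Lemma smooth_periodic_C1 phi : smooth phi -> Defs.periodic phi ->
  periodic_C1 true phi (partial1 phi) /\ periodic_C1 false phi (partial2 phi).
Proof.
move=> sphi pphi; have [cphi [d1 d2 [c1 _] [c2 _]]] := sphi 1%N.
split; split=> //.
- move=> x y /=.
  have pt (h : R) : h *: ((1, 0) : R * R) + (y, x) = (h *: (1 : R) + y, x).
    by rewrite [LHS](_ : _ = (h *: (1 : R) + y, h *: (0 : R) + x))// scaler0 add0r.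
  have e : (fun h : R => h^-1 *:
        (((fun y0 : R => phi (y0, x)) \o shift y) (h *: (1 : R)) - phi (y, x)))
      = (fun h : R => h^-1 *:
        ((phi \o shift (y, x)) (h *: ((1, 0) : R * R)) - phi (y, x))).
    by apply/funext => h /=; rewrite pt.
  by split; [rewrite /derivable e; exact: d1|rewrite /derive e].
- move=> x y /=.
  have pt (h : R) : h *: ((0, 1) : R * R) + (x, y) = (x, h *: (1 : R) + y).
    by rewrite [LHS](_ : _ = (h *: (0 : R) + x, h *: (1 : R) + y))// scaler0 add0r.
  have e : (fun h : R => h^-1 *:
        (((fun y0 : R => phi (x, y0)) \o shift y) (h *: (1 : R)) - phi (x, y)))
      = (fun h : R => h^-1 *:
        ((phi \o shift (x, y)) (h *: ((0, 1) : R * R)) - phi (x, y))).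
    by apply/funext => h /=; rewrite pt.
  by split; [rewrite /derivable e; exact: d2|rewrite /derive e].
Qed.

(** One component of [is_grad]: [g] is the partial derivative of [u], in the
    first coordinate if [b] and in the second otherwise, as a limit of classical
    derivatives. *)
Definition weak_partial (b : bool) (u g : R * R -> R) : Prop :=
  [/\ L2 u, L2 g &
      exists phi dphi : nat -> R * R -> R,
        [/\ forall k, periodic_C1 b (phi k) (dphi k),
            L2cvg phi u & L2cvg dphi g]].

Lemma is_grad_weak_partial u g : is_grad u g ->
  weak_partial true u g.1 /\ weak_partial false u g.2.
Proof.
move=> [[pu Lu] [[_ Lg1] [_ Lg2]] [phi [sp cu c1 c2]]].
have h k := smooth_periodic_C1 (sp k).1 (sp k).2.
by split; split => //; [exists phi, (fun k => partial1 (phi k))|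
    exists phi, (fun k => partial2 (phi k))]; split => // k; have [] := h k.
Qed.

Lemma L2cvg_cst (v : R * R -> R) : L2cvg (fun=> v) v.
Proof.
rewrite /L2cvg subrr (_ : snorm _ = 0); first exact: cvg_cst.
rewrite /snorm /sip (_ : (fun x => _) = (fun=> 0)); last first.
  by apply/funext => x; rewrite mul0r.
by rewrite Rintegral_cst ?mul0r ?sqrtr0//; exact: measurable_Omega.
Qed.

(** Every term of [poincare_smooth] passes to the limit in L2. *)
Lemma poincare_H1 u g : is_grad u g -> zero_mean u ->
  sip u u <= L ^+ 2 * (sip g.1 g.1 + sip g.2 g.2).
Proof.
move=> [[pu Lu] [[_ Lg1] [_ Lg2]] [phi [sp cu c1 c2]]] u0.
have C1 k := smooth_periodic_C1 (sp k).1 (sp k).2.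
have L1 : L2 (fun=> 1 : R) by apply: continuous_L2 => x; exact: cvg_cst.
have Lphi k : L2 (phi k) by have [[+ _ _ _] _] := C1 k; exact: continuous_L2.
have Ld1 k : L2 (partial1 (phi k)).
  by have [[_ + _ _] _] := C1 k; exact: continuous_L2.
have Ld2 k : L2 (partial2 (phi k)).
  by have [_ [_ + _ _]] := C1 k; exact: continuous_L2.
have c11 := L2cvg_cst (fun=> 1 : R).
have S k : L ^+ 2 * sip (phi k) (phi k) - sip (phi k) (fun=> 1) ^+ 2 <=
    L ^+ 4 * (sip (partial1 (phi k)) (partial1 (phi k)) +
              sip (partial2 (phi k)) (partial2 (phi k))).
  have [[cp cd1 _ s1] [_ cd2 _ s2]] := C1 k.
  have -> : sip (phi k) (fun=> 1) = \int[mu]_(z in Om) phi k z.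
    by apply: eq_Rintegral => z _; rewrite mulr1.
  exact: (poincare_smooth cp cd1 cd2 s1 s2).
have m0 : sip u (fun=> 1) = 0.
  by rewrite -[RHS]u0; apply: eq_Rintegral => z _; rewrite mulr1.
have cl : (fun k => L ^+ 2 * sip (phi k) (phi k) -
      sip (phi k) (fun=> 1) ^+ 2) @ \oo
    --> L ^+ 2 * sip u u - sip u (fun=> 1) ^+ 2.
  apply: cvgB; first by apply: cvgMl_tmp; exact: sip_cvg.
  have c := sip_cvg Lphi (fun=> L1) Lu L1 cu c11.
  exact: (cvgM c c).
have cr : (fun k => L ^+ 4 * (sip (partial1 (phi k)) (partial1 (phi k)) +
      sip (partial2 (phi k)) (partial2 (phi k)))) @ \oo
    --> L ^+ 4 * (sip g.1 g.1 + sip g.2 g.2).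
  by apply: cvgMl_tmp; apply: cvgD; exact: sip_cvg.
have := ler_cvg_to cl cr; rewrite m0 expr0n/= subr0 => le.
have L20 : 0 < L ^+ 2 by rewrite exprn_gt0// period_gt0.
rewrite -(ler_pM2l L20) mulrA -exprD; apply: le.
by near=> k; exact: S.
Unshelve. all: by end_near. Qed.

Lemma ae_bounded_continuous (h : R * R -> R) : continuous h ->
  exists M, ae_bounded h M.
Proof.
move=> /continuous_bounded_box[M M0 hM]; exists M; apply: aeW => -[x y] [/= xI yI].
by apply: hM; exact: subset_itv_oo_cc.
Qed.

Lemma L2cvg_mul (w : R * R -> R) (p : nat -> R * R -> R) (u : R * R -> R) M :
  measurable_fun Om w -> ae_bounded w M -> (forall k, L2 (p k)) -> L2 u ->
  L2cvg p u -> L2cvg (fun k z => w z * p k z) (fun z => w z * u z).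
Proof.
move=> mw bw Lp Lu cp; rewrite /L2cvg.
have c0 : (fun k => `|M| * snorm (p k - u)) @ \oo --> (0 : R).
  by rewrite -(mulr0 `|M|); exact: cvgMl_tmp.
apply: (@squeeze_cvgr _ _ _ _ (fun=> 0) (fun k => `|M| * snorm (p k - u)));
  [|exact: cvg_cst|by []].
near=> k; rewrite snorm_ge0/=.
have [_ le] := L2_mul_bounded mw bw (L2B (Lp k) Lu).
have -> : (fun z => w z * p k z) - (fun z => w z * u z) =
    (fun z => w z * (p k - u) z).
  apply/funext => z.
  by rewrite [LHS](_ : _ = w z * p k z - w z * u z)// -mulrBr.
rewrite -sqrtr_sqr -sqrtrM ?sqr_ge0//; exact: ler_wsqrtr.
Unshelve. all: by end_near. Qed.

(** For smooth periodic [u] and [w] the left-hand side is half the integral of the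
    derivative of the periodic function [u * w ^+ 2]. The integrand being a
    product of three functions that converge only in L2, the limits are taken
    one after the other: in [w] while [u] is replaced by a smooth, hence
    bounded, function; then in [u], where the other factors [w * g] and [w * w]
    are fixed and square integrable because [w] is bounded. *)
Lemma trilinear_cancel b u a w g M :
  weak_partial b u a -> weak_partial b w g -> ae_bounded w M ->
  sip u (fun z => w z * g z) + 2^-1 * sip a (fun z => w z * w z) = 0.
Proof.
move=> [Lu La [eta [deta [Ceta ceta cdeta]]]].
move=> [Lw Lg [phi [dphi [Cphi cphi cdphi]]]] bw.
have mw := Lw.1.
have [Lwg _] := L2_mul_bounded mw bw Lg.
have [Lww _] := L2_mul_bounded mw bw Lw.
have Lphi k : L2 (phi k) by have [+ _ _ _] := Cphi k; exact: continuous_L2.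
have Ldphi k : L2 (dphi k) by have [_ + _ _] := Cphi k; exact: continuous_L2.
have Leta k : L2 (eta k) by have [+ _ _ _] := Ceta k; exact: continuous_L2.
have Ldeta k : L2 (deta k) by have [_ + _ _] := Ceta k; exact: continuous_L2.
have smooth_both j k : 2 * sip (fun z => eta j z * phi k z) (dphi k)
    + sip (fun z => deta j z * phi k z) (phi k) = 0.
  have := periodic_C1_integral
    (periodic_C1_mul (Ceta j) (periodic_C1_mul (Cphi k) (Cphi k))).
  move=> <-; have [ce cde _ _] := Ceta j; have [cp cdp _ _] := Cphi k.
  have Lep : L2 (fun z => eta j z * phi k z).
    by apply: continuous_L2 => z; exact: (continuousM (ce z) (cp z)).
  have Ldep : L2 (fun z => deta j z * phi k z).
    by apply: continuous_L2 => z; exact: (continuousM (cde z) (cp z)).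
  have i1 := integrable_mul Lep (Ldphi k); have i2 := integrable_mul Ldep (Lphi k).
  have mO := @measurable_Omega R.
  have i3 : mu.-integrable Om
      (EFin \o (fun z => 2 * (eta j z * phi k z * dphi k z))).
    exact: (integrableZl mO 2 i1).
  rewrite /sip -RintegralZl// -RintegralD//.
  by apply: eq_Rintegral => z _; ring.
have smooth_left j : 2 * sip (eta j) (fun z => w z * g z) +
    sip (deta j) (fun z => w z * w z) = 0.
  have [ce cde _ _] := Ceta j.
  have [M1 b1] := ae_bounded_continuous ce.
  have [M2 b2] := ae_bounded_continuous cde.
  have m1 : measurable_fun Om (eta j) by exact: (Leta j).1.
  have m2 : measurable_fun Om (deta j) by exact: (Ldeta j).1.
  have c1 := sip_cvg (fun k => (L2_mul_bounded m1 b1 (Lphi k)).1) Ldphi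
     (L2_mul_bounded m1 b1 Lw).1 Lg (L2cvg_mul m1 b1 Lphi Lw cphi) cdphi.
  have c2 := sip_cvg (fun k => (L2_mul_bounded m2 b2 (Lphi k)).1) Lphi
     (L2_mul_bounded m2 b2 Lw).1 Lw (L2cvg_mul m2 b2 Lphi Lw cphi) cphi.
  have c := cvgD (cvgMl_tmp (a := 2) c1) c2.
  have c' : (fun k => 2 * sip (fun z => eta j z * phi k z) (dphi k)
    + sip (fun z => deta j z * phi k z) (phi k)) @ \oo --> (0 : R).
    by apply: cvg_near_cst; apply: nearW => k; exact: smooth_both.
  rewrite -[RHS](cvg_unique (@Rhausdorff R) (c _ _) c') //.
  by rewrite /sip; congr (2 * _ + _); apply: eq_Rintegral => z _; ring.
have c1 := sip_cvg Leta (fun=> Lwg) Lu Lwg ceta (L2cvg_cst _).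
have c2 := sip_cvg Ldeta (fun=> Lww) La Lww cdeta (L2cvg_cst _).
have c := cvgD (cvgMl_tmp (a := 2) c1) c2.
have c' : (fun j => 2 * sip (eta j) (fun z => w z * g z) +
    sip (deta j) (fun z => w z * w z)) @ \oo --> (0 : R).
  by apply: cvg_near_cst; apply: nearW => k; exact: smooth_left.
have : 2 * sip u (fun z => w z * g z) + sip a (fun z => w z * w z) = 0.
  exact: (cvg_unique (@Rhausdorff R) (c _ _) c').
by set p := sip u _; set q := sip a _; lra.
Qed.

End Sobolev.

(** * Skew-symmetry of the discrete nonlinear terms *)

Section Mesh.
Variable R : realType.
Local Notation L := (2 * @pi R).
Local Notation Om := (@Omega R).
Local Notation mu := (@leb2 R).
Local Notation leb := (@lebesgue_measure R).
Local Notation plane2 := (measurableTypeR R * measurableTypeR R)%type.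

(** A line is closed, and Tonelli's theorem computes its measure: the sections
    of a line that is not vertical are single points, and a vertical line is the
    product of a point with the real line. *)
Lemma ae_off_line (a b c : R) : (a, b) != (0, 0) ->
  {ae mu, forall x : plane2, a * x.1 + b * x.2 != c}.
Proof.
move=> ab0; pose l (x : R * R) : R := a * x.1 + b * x.2.
have cl : continuous l.
  move=> x; apply: cvgD; apply: cvgMl_tmp; [exact: cvg_fst|exact: cvg_snd].
pose A : set plane2 := l @^-1` [set c].
have mA : measurable A.
  rewrite -[A]setTI; apply: (continuous_measurable2 (D := setT) cl).
    exact: measurableT.
  exact: measurable_set1.
exists A; split => //; last by move=> x /= /negP; rewrite negbK => /eqP.
have [b0|bn0] := eqVneq b 0; last first.
  rewrite /leb2 /product_measure1; apply: integral0_eq => x _ /=.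
  rewrite (_ : xsection A x = [set (c - a * x) / b]) ?lebesgue_measure_set1//.
  apply/seteqP; split => y; rewrite /xsection/= inE /A /l/=.
    by move=> <-; field.
  by move=> ->; field.
have an0 : a != 0 by apply: contra ab0 => /eqP->; rewrite b0.
rewrite (_ : A = [set c / a] `*` setT); last first.
  apply/seteqP; split => -[x y]; rewrite /A /l/= b0 mul0r addr0.
    by move=> <-; split => //; field.
  by case=> -> _; field.
rewrite /leb2 product_measure1E//.
by rewrite [X in (X * _)%E]lebesgue_measure_set1 mul0e.
Qed.

Lemma sum_vertices (V : zmodType) (F : 'I_3 -> V) :
  \sum_i F i = F (inord 0) + F (inord 1) + F (inord 2).
Proof.
rewrite !big_ord_recl big_ord0 addr0 addrA.
by congr (F _ + F _ + F _); apply/val_inj; rewrite /= inordK.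
Qed.

Lemma ord3_cases (i : 'I_3) : [\/ i = inord 0, i = inord 1 | i = inord 2].
Proof.
by case: i => [[|[|[|//]]] p]; [constructor 1|constructor 2|constructor 3];
  apply/val_inj; rewrite /= inordK.
Qed.

Definition on_line (P Q x : R * R) : bool :=
  (Q.2 - P.2) * x.1 + (P.1 - Q.1) * x.2 == (Q.2 - P.2) * P.1 + (P.1 - Q.1) * P.2.

Lemma ae_off_segment (P Q : R * R) : P != Q ->
  {ae mu, forall x : plane2, ~~ on_line P Q x}.
Proof.
move=> PQ; apply: ae_off_line; apply: contra PQ => /eqP[e1 e2].
by apply/eqP; rewrite [P]surjective_pairing [Q]surjective_pairing; congr (_, _); lra.
Qed.

(** A point of a closed triangle with a vanishing barycentric coordinate lies on
    the line through the two other vertices. *)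
Lemma closed_triangle_boundary (K : triangle R) x : closed_triangle K x ->
  open_triangle K x \/ exists i j : 'I_3, i != j /\ on_line (K i) (K j) x.
Proof.
move=> [l [l0 _ s1 ->]].
have [pos|] := boolP [forall i, l i != 0].
  left; exists l; split => // i.
  by rewrite lt_def l0 andbT; move/forallP: pos; exact.
rewrite negb_forall => /existsP[i]; rewrite negbK => /eqP li0; right.
have s1' : l (inord 0) + l (inord 1) + l (inord 2) = 1 by rewrite -sum_vertices.
rewrite /barycenter !sum_vertices.
have ne (a b : nat) : (a < 3)%N -> (b < 3)%N -> a != b ->
    (inord a : 'I_3) != inord b.
  move=> a3 b3 ab; apply: contra ab => /eqP/(congr1 val).
  by rewrite /= !inordK// => ->.
case: (ord3_cases i) => e; rewrite e in li0.
- exists (inord 1), (inord 2); split; first exact: ne.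
  have -> : l (inord 2) = 1 - l (inord 1) by lra.
  by rewrite /on_line /= li0; apply/eqP; ring.
- exists (inord 0), (inord 2); split; first exact: ne.
  have -> : l (inord 2) = 1 - l (inord 0) by lra.
  by rewrite /on_line /= li0; apply/eqP; ring.
- exists (inord 0), (inord 1); split; first exact: ne.
  have -> : l (inord 1) = 1 - l (inord 0) by lra.
  by rewrite /on_line /= li0; apply/eqP; ring.
Qed.

Lemma area_gt0_inj (K : triangle R) : 0 < area K -> injective K.
Proof.
move=> aK i j; case: (eqVneq i j) => // ij Kij; exfalso; move: aK; apply/negP.
rewrite -leNgt /area /vx; rewrite (_ : _ - _ = 0) ?normr0 ?mul0r//.
case: (ord3_cases i) (ord3_cases j) ij Kij => -> [] -> ; rewrite ?eqxx// => _ e;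
  rewrite e; ring.
Qed.

Lemma ae_open_triangle (D : fe_discretization R) :
  {ae mu, forall x : plane2, Om x -> exists k, open_triangle (@mesh R D k) x}.
Proof.
have [aT cov _ _ _] := mesh_triangulation D.
have h : {ae mu, forall x : plane2, forall p : 'I_(ncells D) * ('I_3 * 'I_3),
    p.2.1 != p.2.2 -> ~~ on_line (@mesh R D p.1 p.2.1) (@mesh R D p.1 p.2.2) x}.
  apply: filter_forall => -[k [i j]] /=; case: (eqVneq i j) => [_|ij].
    by apply: aeW.
  have Kij : @mesh R D k i != @mesh R D k j.
    by apply: contra ij => /eqP/(area_gt0_inj (aT k))->.
  by apply: filterS (ae_off_segment Kij) => x.
apply: filterS h => x off [/= x1 x2].
have : (`[0, L] `*` `[0, L]) x by split; exact: subset_itv_oo_cc.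
rewrite -cov => -[k _ /closed_triangle_boundary[|[i [j [ij onl]]]]].
  by exists k.
by have := off (k, (i, j)) ij; rewrite onl.
Qed.

(** Up to a null set the square is covered by the open triangles of the mesh, on
    each of which the function is a polynomial; a polynomial is bounded on the
    square by the sum of the absolute values of its monomials at the far corner. *)
Lemma piecewise_poly_ae_bounded (D : fe_discretization R) d w :
  piecewise_poly d (@mesh R D) w -> exists M, ae_bounded w M.
Proof.
move=> /choice[c hc].
pose B k := \sum_(i < d.+1) \sum_(j < d.+1 - i) `|c k i j| * L ^+ i * L ^+ j.
have B0 k : 0 <= B k.
  apply: sumr_ge0 => i _; apply: sumr_ge0 => j _.
  by rewrite !mulr_ge0// exprn_ge0// ltW// period_gt0.
exists (\sum_k B k).
apply: filterS (ae_open_triangle D) => -[x y] /[swap] -[/= xI yI].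
move=> /(_ (conj xI yI))[k /hc ->] /=.
apply: (@le_trans _ _ (B k)); last first.
  by rewrite (bigD1 k)//= lerDl sumr_ge0.
have pw (z : R) n : z \in `]0, L[ -> `|z ^+ n| <= L ^+ n.
  rewrite in_itv/= => /andP[z0 zL]; rewrite normrX (gtr0_norm z0).
  by apply: lerXn2r; rewrite ?nnegrE ltW// period_gt0.
apply: le_trans (ler_norm_sum _ _ _) _; apply: ler_sum => i _.
apply: le_trans (ler_norm_sum _ _ _) _; apply: ler_sum => j _.
rewrite !normrM; apply: ler_pM => //; last exact: pw.
by apply: ler_pM => //; exact: pw.
Qed.

Lemma gradP (u : sfield R) : H1per u -> is_grad u (grad u).
Proof. by move=> [_ [g ug]]; apply: (xgetPex 0); exists g. Qed.

(** Skew-symmetry of the convective form in its last two arguments, at equal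
    arguments; it is [trilinear_cancel] for each component of [u]. The
    boundedness that it requires holds because [w] is a piecewise polynomial. *)
Lemma bstar_cancel (D : fe_discretization R) u w : vH1per u -> Yh D w ->
  bstar u w w = 0.
Proof.
move=> [u1 u2] Yw; have Hw := Yh_H1per Yw.
have [M bw] := piecewise_poly_ae_bounded (Yh_piecewise_poly Yw).
have [w1 w2] := is_grad_weak_partial (gradP Hw).
have [u11 _] := is_grad_weak_partial (gradP u1).
have [_ u22] := is_grad_weak_partial (gradP u2).
have e1 := trilinear_cancel u11 w1 bw; have e2 := trilinear_cancel u22 w2 bw.
have [Lu1 La1 _] := u11; have [Lu2 La2 _] := u22.
have [Lw Lg1 _] := w1; have [_ Lg2 _] := w2.
have [Lwg1 _] := L2_mul_bounded Lw.1 bw Lg1.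
have [Lwg2 _] := L2_mul_bounded Lw.1 bw Lg2.
have [Lww _] := L2_mul_bounded Lw.1 bw Lw.
rewrite /bstar /div.
have -> : sip (fun x => u.1 x * (grad w).1 x + u.2 x * (grad w).2 x) w =
    sip u.1 (fun z => w z * (grad w).1 z) + sip u.2 (fun z => w z * (grad w).2 z).
  rewrite /sip -RintegralD; last 3 first.
  - exact: measurable_Omega.
  - exact: integrable_mul.
  - exact: integrable_mul.
  by apply: eq_Rintegral => z _; ring.
have -> : sip (fun x => ((grad u.1).1 + (grad u.2).2) x * w x) w =
    sip (grad u.1).1 (fun z => w z * w z) + sip (grad u.2).2 (fun z => w z * w z).
  rewrite /sip -RintegralD; last 3 first.
  - exact: measurable_Omega.
  - exact: integrable_mul.
  - exact: integrable_mul.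
  apply: eq_Rintegral => z _.
  rewrite [((grad u.1).1 + (grad u.2).2) z]
    (_ : _ = (grad u.1).1 z + (grad u.2).2 z)//.
  by ring.
by rewrite -[RHS](addr0 0) -{1}e1 -e2; ring.
Qed.

(** True for every [h]: the integral is the difference of two elements of
    [[0, +oo]], and [fine (a - b) = - fine (b - a)] for all extended reals,
    the value of [fine] at infinity being 0. *)
Lemma Rintegral_opp d (T : measurableType d) (m : {measure set T -> \bar R})
    (A : set T) (h : T -> R) :
  \int[m]_(x in A) (- h x) = - \int[m]_(x in A) h x.
Proof.
rewrite /Rintegral integralE [in RHS]integralE.
have -> : (fun x => (- h x)%:E) = (fun x => - (h x)%:E)%E by [].
rewrite (_ : (fun x => - (h x)%:E)%E = (\- (fun x => (h x)%:E))%E)//.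
rewrite funeposN funenegN.
case: (\int[m]_(x in A) _)%E => [r| |]; case: (\int[m]_(x in A) _)%E => [s| |];
  by rewrite /= ?oppr0 ?opprB.
Qed.

(** The vector [w x v] is pointwise orthogonal to [v]. *)
Lemma wcross_cancel (w : sfield R) (v : vfield R) : vip (wcross w v) v = 0.
Proof.
rewrite /vip /sip /=.
rewrite -[RHS](subrr (\int[mu]_(x in Om) (v.1 x * w x * v.2 x))) addrC.
congr (_ + _).
rewrite -Rintegral_opp; apply: eq_Rintegral => x _; ring.
Qed.

End Mesh.

(** * Stability of the scheme *)

Section Scheme.
Variable R : realType.
Local Notation L := (2 * @pi R).

Lemma H1per_grad_L2 (w : sfield R) : H1per w -> vL2 (grad w).
Proof. by move=> /gradP[_ [[_ ?] [_ ?]] _]. Qed.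

Lemma H1per_L2 (w : sfield R) : H1per w -> L2 w.
Proof. by move=> [[_ Lw _] _]. Qed.

Lemma poincare_scalar (w : sfield R) : H1per w ->
  sip w w <= L ^+ 2 * vip (grad w) (grad w).
Proof. by move=> Hw; have [[_ _ w0] _] := Hw; exact: poincare_H1 (gradP Hw) w0. Qed.

Lemma poincare_vector (v : vfield R) : vH1per v -> vip v v <= L ^+ 2 * gradip v v.
Proof.
move=> [H1 H2]; rewrite /gradip mulrDr.
by apply: lerD; exact: poincare_scalar.
Qed.

Lemma gradip_ge0 (v : vfield R) : vH1per v -> 0 <= gradip v v.
Proof.
move=> [H1 H2]; apply: addr_ge0; apply: (ip_ge0 (vip_semi_inner R)).
  exact: H1per_grad_L2.
exact: H1per_grad_L2.
Qed.

Lemma vH1per_vL2 (v : vfield R) : vH1per v -> vL2 v.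
Proof. by move=> [H1 H2]; split; exact: H1per_L2. Qed.

Lemma young (nu a b : R) : 0 < nu ->
  a * b <= nu / 2 * a ^+ 2 + (2 * nu)^-1 * b ^+ 2.
Proof.
move=> nu0; have n0 : nu != 0 by rewrite gt_eqF.
have : 0 <= (2 * nu)^-1 * (nu * a - b) ^+ 2.
  by rewrite mulr_ge0 ?sqr_ge0// invr_ge0 mulr_ge0// ltW.
rewrite (_ : _ * (nu * a - b) ^+ 2 =
   (nu / 2 * a ^+ 2 + (2 * nu)^-1 * b ^+ 2) - a * b) ?subr_ge0//.
by field.
Qed.

Lemma Linf_le (N : R -> \bar R) t x :
  Linf_bounded N -> 0 < t -> (x%:E <= N t)%E ->
  x <= Linf_norm N.
Proof.
move=> [fin le] t0 xN; have h := le_trans xN (le t t0).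
rewrite -lee_fin /Linf_norm fineK// fin_numE; apply/andP; split.
  by rewrite gt_eqF// (lt_le_trans _ h)// ltNyr.
by rewrite lt_eqF.
Qed.

(** When [v] vanishes in L2 the pairing is 0 and the right-hand side is
    nonnegative. Otherwise Vh is nontrivial, so the dual norm is a supremum over
    a set that contains [f t v / gradnorm v], the Poincare inequality making the
    denominator positive. *)
Lemma dual_pairing_le (nu : R) (D : fe_discretization R) f t v :
  0 < nu -> Linf_dual D f -> 0 < t -> Vh D v ->
  f t v <= nu / 2 * gradip v v
     + (2 * nu)^-1 * Linf_norm (fun t => dual_norm D (f t)) ^+ 2.
Proof.
move=> nu0 [lin _ bd] t0 Vv; have [Xv _] := Vv.
have Hv := Xh_vH1per Xv; have g0 := gradip_ge0 Hv.
have c0 : 0 <= (2 * nu)^-1 by rewrite invr_ge0 mulr_ge0// ltW.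
have [v0|vn0] := eqVneq (vnorm v) 0.
  have -> : f t v = 0 := (lin t t0).2 v Xv v0.
  apply: addr_ge0; apply: mulr_ge0 => //; last exact: sqr_ge0.
  by rewrite divr_ge0// ltW.
have gn0 : 0 < gradnorm v.
  rewrite sqrtr_gt0 lt_def g0 andbT; apply: contra vn0 => /eqP gv0.
  have := poincare_vector Hv; rewrite gv0 mulr0 => h.
  by rewrite /vnorm ler0_sqrtr.
have e : gradip v v = gradnorm v ^+ 2 by rewrite sqr_sqrtr.
have : f t v / gradnorm v <= Linf_norm (fun t => dual_norm D (f t)).
  by apply: (Linf_le bd t0); apply: ereal_sup_ubound; exists v.
rewrite ler_pdivrMr// mulrC => h; apply: le_trans h _; rewrite e; exact: young.
Qed.

(** Young's inequality on each of the two terms; the square completed is that of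
    [g.1 - nu * (grad w).2], resp. [g.2 + nu * (grad w).1]. *)
Lemma curl_pairing_le (nu : R) (g : vfield R) w : 0 < nu -> vL2 g -> H1per w ->
  curl_pairing g w <= nu / 2 * vip (grad w) (grad w) + (2 * nu)^-1 * vip g g.
Proof.
move=> nu0 [Lg1 Lg2] Hw; have [La Lb] := H1per_grad_L2 Hw.
have i1 := integrable_mul Lg1 Lb; have i2 := integrable_mul Lg2 La.
have mO := @measurable_Omega R.
rewrite /curl_pairing RintegralB// -/(sip _ _) -/(sip _ _).
have S := sip_semi_inner R.
have n0 : nu != 0 by rewrite gt_eqF.
have y (u v : sfield R) (s : R) : L2 u -> L2 v -> s ^+ 2 = 1 ->
   s * sip u v <= nu / 2 * sip v v + (2 * nu)^-1 * sip u u.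
  move=> Lu Lv s1.
  have := ip_ge0 S (subspaceB S Lu (subspaceZ S (s * nu) Lv)).
  rewrite (ip_sqB S)// => p.
  have c0 : 0 <= (2 * nu)^-1 by rewrite invr_ge0 mulr_ge0// ltW.
  have := mulr_ge0 c0 p; rewrite exprMn s1 mul1r.
  move: (sip u u) (sip u v) (sip v v) => A B C.
  rewrite (_ : _ * (A - _ + _) = nu / 2 * C + (2 * nu)^-1 * A - s * B).
    by rewrite subr_ge0.
  by field.
have y1 := y _ _ 1 Lg1 Lb (expr1n _ _).
have s1 : (-1) ^+ 2 = 1 :> R by rewrite sqrrN expr1n.
have y2 := y _ _ (-1) Lg2 La s1.
rewrite /vip; move: y1 y2; rewrite mul1r mulN1r !mulrDr; lra.
Qed.

End Scheme.

Unset Implicit Arguments.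

Theorem theorem4p1 (R : realType) (nu : R) (hnu : 0 < nu) :
  exists Cl Cu : R,
    [/\ 0 < Cl, 0 < Cu, G_equivalence Cl Cu,
    (forall (D : fe_discretization R)
            (IX : vfield R -> vfield R) (IY : sfield R -> sfield R)
            (f : R -> vfield R -> R) (curlf : R -> sfield R -> R)
            (u0 : vfield R) (dt : R)
            (u : nat -> vfield R) (P : nat -> sfield R) (w : nat -> sfield R),
       interpolations D IX IY ->
       Linf_dual D f ->
       (forall t, 0 < t -> is_functional (@snorm R) (Yh D) (curlf t)) ->
       vH1per u0 ->
       0 < dt ->
       bdf2_solution nu dt D IX IY f curlf u0 u P w ->
       let alpha := Num.min (1 / 2) (nu * dt * Cl ^+ 2 / 4) in
       forall n : nat, (0 < n)%N ->
         Cl ^+ 2 * (vnorm (u n) ^+ 2 + vnorm (u n.-1) ^+ 2)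
           + nu * dt / 4 * gradnorm (u n) ^+ 2
         <= (1 / (1 + alpha)) ^+ n
              * (2 * Cu * vnorm (u 0%N) ^+ 2
                 + nu * dt / 4 * gradnorm (u 0%N) ^+ 2)
            + Num.max (2 * dt) (4 / (nu * Cl ^+ 2)) * nu^-1
              * Linf_norm (fun t => dual_norm D (f t)) ^+ 2) &
    (forall (D : fe_discretization R)
            (IX : vfield R -> vfield R) (IY : sfield R -> sfield R)
            (f : R -> vfield R) (u0 : vfield R) (dt : R)
            (u : nat -> vfield R) (P : nat -> sfield R) (w : nat -> sfield R),
       interpolations D IX IY ->
       Linf_L2 f ->
       vH1per u0 ->
       H1per (w 0%N) ->
       0 < dt ->
       bdf2_solution nu dt D IX IY
         (fun t => vip (f t)) (fun t => curl_pairing (f t)) u0 u P w ->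
       let alpha := Num.min (1 / 2) (nu * dt * Cl ^+ 2 / 4) in
       forall n : nat, (0 < n)%N ->
         Cl ^+ 2 * (snorm (w n) ^+ 2 + snorm (w n.-1) ^+ 2)
           + nu * dt / 4 * vnorm (grad (w n)) ^+ 2
         <= (1 / (1 + alpha)) ^+ n
              * (2 * Cu * snorm (w 0%N) ^+ 2
                 + nu * dt / 4 * vnorm (grad (w 0%N)) ^+ 2)
            + Num.max (2 * dt) (4 / (nu * Cl ^+ 2)) * nu^-1
              * Linf_norm (fun t => (vnorm (f t))%:E) ^+ 2)].
Proof.
pose L : R := 2 * pi; have L0 : 0 < L by exact: period_gt0.
(* Small enough for [Cl <= 1 / 4], so that [Cl ^+ 2] is below the smallest
   eigenvalue of G, and for [4 * Cl ^+ 2 * L ^+ 2 <= 1], where [L ^+ 2] is the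
   Poincare constant. *)
pose Cl := (4 * (1 + L))^-1.
have L4 : 0 < 4 * (1 + L) by rewrite mulr_gt0// addr_gt0.
have Cl0 : 0 < Cl by rewrite invr_gt0.
have Cle : Cl * (4 * (1 + L)) = 1 by rewrite mulVf// gt_eqF.
have ClL : 0 < Cl * L by rewrite mulr_gt0.
have Cl4 : Cl <= 1 / 4 by lra.
have ClP : 4 * Cl ^+ 2 * L ^+ 2 <= 1.
  have h : Cl * L <= 1 / 4 by lra.
  rewrite (_ : 4 * Cl ^+ 2 * L ^+ 2 = 4 * (Cl * L) ^+ 2); last by ring.
  by rewrite expr2; nra.
have CP0 : 0 < L ^+ 2 by rewrite exprn_gt0.
have nudt dt : 0 < dt -> 0 <= nu * dt / 4 by move=> dt0; rewrite divr_ge0// mulr_ge0// ltW.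
have sS := sip_semi_inner R; have vS := vip_semi_inner R.
exists Cl, 4; split=> //.
- by split=> chi Lchi;
    [apply: (G_equivalence_ip sS)|apply: (G_equivalence_ip vS)] => //;
    apply/andP; split; lra.
- move=> D IX IY f curlf u0 dt u P w _ bf _ _ dt0 [_ XY QP momentum _] alpha n _.
  have Xu k : Xh D (u k) := (XY k).1.
  have Hu k : vH1per (u k) := Xh_vH1per (Xu k).
  have Lu k : vL2 (u k) := vH1per_vL2 (Hu k).
  have gu0 k : 0 <= gradip (u k) (u k) := gradip_ge0 (Hu k).
  have poinc k := poincare_vector (Hu k).
  have step k :
     1 / (2 * dt)
       * vip (3%:R *: u k.+1 - 4%:R *: u k + u k.-1 : vfield R) (u k.+1)
     + nu * gradip (u k.+1) (u k.+1) <= nu / 2 * gradip (u k.+1) (u k.+1)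
     + (2 * nu)^-1 * Linf_norm (fun t => dual_norm D (f t)) ^+ 2.
    have [mom dfree] := momentum k.
    have tk : 0 < k.+1%:R * dt by rewrite mulr_gt0// ltr0n.
    have Vu : Vh D (u k.+1) by split.
    apply: le_trans (dual_pairing_le hnu bf tk Vu).
    have p0 : sip (P k.+1) (div (u k.+1)) = 0.
      by rewrite -(dfree (P k.+1) (QP k)); apply: eq_Rintegral => x _; rewrite mulrC.
    by rewrite -mom// wcross_cancel p0 addr0 subr0.
  have gE k : gradnorm (u k) ^+ 2 = gradip (u k) (u k) by rewrite sqr_sqrtr.
  (* Generalising each norm keeps the rewriting from comparing integrals. *)
  move: (gradnorm (u n)) (gE n) => ? ->.
  move: (gradnorm (u 0%N)) (gE 0%N) => ? ->.
  move: (vnorm (u n)) (sqr_vnorm (Lu n)) => ? ->.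
  move: (vnorm (u n.-1)) (sqr_vnorm (Lu n.-1)) => ? ->.
  move: (vnorm (u 0%N)) (sqr_vnorm (Lu 0%N)) => ? ->.
  apply: le_trans (bdf2_decay vS hnu dt0 Cl0 CP0 Cl4 ClP Lu gu0 poinc step n) _.
  rewrite lerD2r; apply: ler_wpM2l; last first.
    rewrite lerD2r; have := ip_ge0 vS (Lu 0%N); lra.
  rewrite exprn_ge0// divr_ge0// addr_ge0// le_min; apply/andP; split; first lra.
  by rewrite divr_ge0// mulr_ge0 ?sqr_ge0// mulr_ge0// ltW.
- move=> D IX IY f u0 dt u P w _ [Lf _ bf] _ _ dt0 [_ XY _ _ vorticity] alpha n _.
  have Yw k : Yh D (w k) := (XY k).2.
  have Hu k : vH1per (u k) := Xh_vH1per (XY k).1.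
  have Hw k : H1per (w k) := Yh_H1per (Yw k).
  have Lw k : L2 (w k) := H1per_L2 (Hw k).
  have Lgw k : vL2 (grad (w k)) := H1per_grad_L2 (Hw k).
  have gw0 k : 0 <= vip (grad (w k)) (grad (w k)) := ip_ge0 vS (Lgw k).
  have poinc k := poincare_scalar (Hw k).
  have step k :
     1 / (2 * dt)
       * sip (3%:R *: w k.+1 - 4%:R *: w k + w k.-1 : sfield R) (w k.+1)
     + nu * vip (grad (w k.+1)) (grad (w k.+1))
     <= nu / 2 * vip (grad (w k.+1)) (grad (w k.+1))
     + (2 * nu)^-1 * Linf_norm (fun t => (vnorm (f t))%:E) ^+ 2.
    have tk : 0 < k.+1%:R * dt by rewrite mulr_gt0// ltr0n.
    have Lfk : vL2 (f (k.+1%:R * dt)) by have [[_ ? _] [_ ? _]] := Lf _ tk.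
    have := vorticity k (w k.+1) (Yw k.+1).
    rewrite (bstar_cancel (Hu k.+1) (Yw k.+1)) addr0 => ->.
    apply: le_trans (curl_pairing_le hnu Lfk (Hw k.+1)) _; rewrite lerD2l.
    apply: ler_wpM2l; first by rewrite invr_ge0 mulr_ge0// ltW.
    rewrite -sqr_vnorm//; have h := Linf_le bf tk (lexx _).
    by rewrite lerXn2r// nnegrE ?(le_trans _ h)// sqrtr_ge0.
  move: (vnorm (grad (w n))) (sqr_vnorm (Lgw n)) => ? ->.
  move: (vnorm (grad (w 0%N))) (sqr_vnorm (Lgw 0%N)) => ? ->.
  move: (snorm (w n)) (sqr_snorm (Lw n)) => ? ->.
  move: (snorm (w n.-1)) (sqr_snorm (Lw n.-1)) => ? ->.
  move: (snorm (w 0%N)) (sqr_snorm (Lw 0%N)) => ? ->.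
  apply: le_trans (bdf2_decay sS hnu dt0 Cl0 CP0 Cl4 ClP Lw gw0 poinc step n) _.
  rewrite lerD2r; apply: ler_wpM2l; last first.
    rewrite lerD2r; have := ip_ge0 sS (Lw 0%N); lra.
  rewrite exprn_ge0// divr_ge0// addr_ge0// le_min; apply/andP; split; first lra.
  by rewrite divr_ge0// mulr_ge0 ?sqr_ge0// mulr_ge0// ltW.
Qed.
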